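(* Let $X$ be a real Banach space whose dual $X^*$ is isometrically isomorphic to $\ell_1$ (an $\ell_1$-predual). Then $$r^*(X)=\sup\left\{\|g^*\| : g^*\in(\operatorname{ext} B_{X^*})'\right\}=\sup\left\{\|\alpha\| : \alpha\in B_{\ell_1},\ X \text{ contains a subspace isometric to } W_\alpha\right\},$$ where the first equality is the definition of $r^*(X)$.
   Context: All spaces are real. $B_Z$ is the closed unit ball of $Z$, and $\operatorname{ext} K$ is the set of extreme points of a convex set $K$. For $A\subseteq X^*$, $A'$ denotes the set of $\sigma(X^*,X)$-cluster points (weak*-accumulation points) of the set $A$. For an $\ell_1$-predual $X$, $r^*(X):=\sup\{\|g^*\| : g^*\in(\operatorname{ext} B_{X^*})'\}$. Let $c$ be the space of convergent real sequences with the sup norm. For $\alpha=(\alpha(1),\alpha(2),\dots)\in B_{\ell_1}$, $W_\alpha$ is the closed subspace (with sup norm) $W_\alpha=\{x\in c:\ \lim_{i\to\infty}x(i)=\sum_{i=1}^\infty \alpha(i)x(i)\}$. *)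

(* Defs.v *)
From HB Require Import structures.
From mathcomp Require Import all_boot all_order all_algebra.
From mathcomp Require Import all_classical all_reals all_analysis.
Import Order.TTheory GRing.Theory Num.Theory.
Import numFieldNormedType.Exports.

Set Implicit Arguments.
Unset Strict Implicit.
Unset Printing Implicit Defensive.

Local Open Scope classical_set_scope.
Local Open Scope ring_scope.

(* Concrete normed spaces (the dual of X, ell_1, W_alpha) are represented by a
   carrier, i.e. a set in an ambient vector space of functions with the
   pointwise operations, together with a norm that is meaningful on that
   carrier.  The codomain is R^o so that the function space is an lmodType. *)

Section Generic.
Context {R : realType}.

Definition is_subspace (V : lmodType R) (A : set V) : Prop :=
  A 0 /\ forall (a : R) (x y : V), A x -> A y -> A (a *: x + y).

Definition isometrically_isomorphic (V W : lmodType R)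
    (A : set V) (normA : V -> R) (B : set W) (normB : W -> R) : Prop :=
  exists T : V -> W,
    [/\ set_bij A B T,
        forall (a : R) (x y : V), A x -> A y -> T (a *: x + y) = a *: T x + T y
      & forall x : V, A x -> normB (T x) = normA x].

Definition ext (V : lmodType R) (K : set V) : set V :=
  [set x | K x /\ forall (y z : V) (t : R), K y -> K z -> 0 < t < 1 ->
                    x = t *: y + (1 - t) *: z -> y = x /\ z = x].

End Generic.

Section Dual.
Context {R : realType} (X : completeNormedModType R).

Definition dual : set (X -> R^o) :=
  [set f | linear f /\ continuous (f : X -> R)].

Definition dual_norm (f : X -> R^o) : R :=
  sup [set `|f x| | x in [set x : X | `|x| <= 1]].

Definition dual_ball : set (X -> R^o) :=
  [set f | dual f /\ dual_norm f <= 1].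

(* sigma(X^*, X) is the topology induced on the dual by the topology of
   pointwise convergence; limit_point is the punctured notion (every
   neighbourhood of g meets A in a point different from g). *)
Definition weakstar_cluster (A : set (X -> R^o)) : set (X -> R^o) :=
  [set g | dual g /\ @limit_point {ptws X -> R} A g].

(* The supremum is taken in the extended reals, so that it carries no default
   value for empty or unbounded sets. *)
Definition rstar : \bar R :=
  ereal_sup [set (dual_norm g)%:E | g in weakstar_cluster (ext dual_ball)].

End Dual.

Section Sequences.
Context {R : realType}.

Definition ell1 : set (nat -> R^o) :=
  [set a | cvgn (series (fun i => `|a i| : R))].

Definition ell1_norm (a : nat -> R^o) : R := limn (series (fun i => `|a i| : R)).

Definition ell1_ball : set (nat -> R^o) :=
  [set a | ell1 a /\ ell1_norm a <= 1].

Definition sup_norm (x : nat -> R^o) : R := sup [set `|x i| | i in setT].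

Definition W (alpha : nat -> R^o) : set (nat -> R^o) :=
  [set x | cvgn (x : nat -> R) /\
           limn (x : nat -> R) = limn (series (fun i => alpha i * x i : R))].

End Sequences.

Section Preduals.
Context {R : realType} (X : completeNormedModType R).

Definition ell1_predual : Prop :=
  isometrically_isomorphic (@dual R X) (@dual_norm R X) ell1 ell1_norm.

Definition contains_isometric_copy
    (V : lmodType R) (B : set V) (normB : V -> R) : Prop :=
  exists Y : set X, [/\ is_subspace Y, closed Y
    & isometrically_isomorphic Y (fun y : X => `|y|) B normB].

End Preduals.

(* Main.v *)
Require Import Defs.
From HB Require Import structures.
From mathcomp Require Import all_boot all_order all_algebra.
From mathcomp Require Import all_classical all_reals all_analysis.
From mathcomp Require Import ring lra.
Import Order.TTheory GRing.Theory Num.Theory.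
Import numFieldNormedType.Exports.

Set Implicit Arguments.
Unset Strict Implicit.
Unset Printing Implicit Defensive.

Local Open Scope classical_set_scope.
Local Open Scope ring_scope.

(* The dual of X is l1 with basis functionals e_n, and the extreme points of its
   ball are the +-e_n.

   A cluster point g of the +-e_n, up to eps: fix N with sum_(i >= N) |g_i| small
   and build an increasing tower of copies of l_oo^m in X, m = N, N + 1, ..., whose
   coordinate functionals F_0, F_1, ... are e_0, ..., e_(N-1) followed by basis
   functionals +-e_n that are closer and closer to g on the part already built, each
   new direction having all earlier e_k equal to 0, hence g small.  The tower
   extends isometrically since balls meeting coordinatewise in the bidual l_oo meet
   in X, even with finitely many coordinates prescribed (Hahn-Banach up to eps, then
   a convergent correction).  On the closure of the tower F_k tends to
   g = sum_k alpha_k F_k, so y |-> (F_k y)_k is an isometry onto W alpha, and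
   |alpha| is close to |g|.

   Conversely, on a copy Y of W alpha each coordinate i with |alpha_i| <= 1/4 is
   strongly exposed, so its Hahn-Banach extension forces it to be the restriction
   of some +-e_n; a cluster point of these functionals restricts to the limit
   functional of W alpha, whose norm is |alpha|. *)

(** * Hahn-Banach *)

(** The copies of W alpha have to be exactly isometric, whereas separation only brings
    finite-dimensional pieces of the bidual into X up to eps; so ball intersections are solved
    exactly before any tower is built. In the tower, the coordinate vectors already present must be
    corrected by multiples of each new vector to stay biorthogonal to the enlarged family of
    functionals. They move with the stage, and alpha_k is the limit of the values of g on the k-th
    one; geometric tolerances make the changes of these values summable. Beginning with e_0, ...,
    e_(N-1) ties the first N entries of alpha to the coefficients of g, which keeps the norm of
    alpha large. The loss of eps is harmless since only suprema are compared. In the converse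
    direction, at most three coordinates have |alpha_i| > 1/4, and a cluster point of a sequence
    ignores finitely many terms. *)

Section LinearForms.
Context {R : realType} {V : lmodType R}.
Implicit Types f g : V -> R.

Definition linear_form f : Prop :=
  forall (a : R) (x y : V), f (a *: x + y) = a * f x + f y.

Lemma linear_form0 f : linear_form f -> f 0 = 0.
Proof.
move=> lf; have := lf 1 0 0; rewrite scaler0 addr0 mul1r => h.
by apply: (addrI (f 0)); rewrite addr0 -h.
Qed.

Lemma linear_formD f x y : linear_form f -> f (x + y) = f x + f y.
Proof. by move=> lf; rewrite -[x]scale1r lf mul1r scale1r. Qed.

Lemma linear_formZ f a x : linear_form f -> f (a *: x) = a * f x.
Proof. by move=> lf; rewrite -[a *: x]addr0 lf linear_form0// addr0. Qed.

Lemma linear_formN f x : linear_form f -> f (- x) = - f x.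
Proof. by move=> lf; rewrite -scaleN1r linear_formZ// mulN1r. Qed.

Lemma linear_formB f x y : linear_form f -> f (x - y) = f x - f y.
Proof. by move=> lf; rewrite linear_formD// linear_formN. Qed.

Lemma linear_form_sum f (I : Type) (r : seq I) (P : pred I) (x : I -> V) :
  linear_form f -> f (\sum_(i <- r | P i) x i) = \sum_(i <- r | P i) f (x i).
Proof.
move=> lf; apply: (big_morph f) => [u v|]; first exact: linear_formD.
exact: linear_form0.
Qed.

End LinearForms.

Section HahnBanach.
Context {R : realType} {V : lmodType R}.
Implicit Types p q : V -> R.

(** Homogeneity is an inequality for [a > 0] only, the form that infima and maxima inherit; equality
    follows by applying it to the inverse of [a]. *)
Definition sublinear p : Prop :=
  (forall x y, p (x + y) <= p x + p y) /\
  (forall a x, 0 < a -> p (a *: x) <= a * p x).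

Lemma sublinearZ p a x : sublinear p -> 0 < a -> p (a *: x) = a * p x.
Proof.
move=> [_ pZ] a0; apply/eqP; rewrite eq_le pZ//=.
have ai : 0 < a^-1 by rewrite invr_gt0.
have := pZ a^-1 (a *: x) ai; rewrite scalerA mulVf ?gt_eqF// scale1r.
by rewrite -(ler_pM2l a0) mulrA mulfV ?gt_eqF// mul1r.
Qed.

Lemma sublinear0 p : sublinear p -> p 0 = 0.
Proof.
move=> sp; have := @sublinearZ p 2 0 sp (ltr0Sn _ 1); rewrite scaler0 => h.
by lra.
Qed.

Lemma sublinear_opp_le p x : sublinear p -> - p (- x) <= p x.
Proof.
by move=> sp; have := sp.1 x (- x); rewrite subrr sublinear0//; lra.
Qed.

(** A pair [(x, c)] of [G] records a constraint [c <= f x] on the linear form [f] to be found. *)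
Definition convex_cone (G : set (V * R)) : Prop :=
  [/\ G (0, 0), forall k l, G k -> G l -> G (k.1 + l.1, k.2 + l.2)
    & forall a k, 0 < a -> G k -> G (a *: k.1, a * k.2)].

Definition ray (x : V) (c : R) : set (V * R) :=
  [set k | exists2 t : R, 0 <= t & k = (t *: x, t * c)].

Lemma ray_cone x c : convex_cone (ray x c).
Proof.
split; first by exists 0; rewrite ?scale0r ?mul0r.
  move=> _ _ [s s0 ->] [t t0 ->]; exists (s + t); first exact: addr_ge0.
  by rewrite scalerDl mulrDl.
move=> a _ a0 [s s0 ->]; exists (a * s); first by rewrite mulr_ge0// ltW.
by rewrite scalerA mulrA.
Qed.

(** A linear form below this functional is below [p], by the pair [(0, 0)], and meets every
    constraint of [G], since the value at [- k.1] is at most [- k.2]. *)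
Definition cone_inf p (G : set (V * R)) (x : V) : R :=
  inf [set p (x + k.1) - k.2 | k in G].

Section ConeInf.
Variables (p : V -> R) (G : set (V * R)).
Hypotheses (sp : sublinear p) (cG : convex_cone G)
  (Gp : forall k, G k -> k.2 <= p k.1).

Let has_lb x : has_lbound [set p (x + k.1) - k.2 | k in G].
Proof.
exists (- p (- x)) => _ [k Gk <-].
have := sp.1 (x + k.1) (- x); rewrite addrAC subrr add0r.
by have := Gp Gk; lra.
Qed.

Let ne x : [set p (x + k.1) - k.2 | k in G] !=set0.
Proof. by case: cG => G0 _ _; exists (p (x + 0) - 0), (0, 0). Qed.

Lemma cone_inf_le x k : G k -> cone_inf p G x <= p (x + k.1) - k.2.
Proof. by move=> Gk; apply: ge_inf => //; exists k. Qed.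

Lemma le_cone_inf x a : (forall k, G k -> a <= p (x + k.1) - k.2) ->
  a <= cone_inf p G x.
Proof. by move=> h; apply: (lb_le_inf (ne x)) => _ [k Gk <-]; exact: h. Qed.

Lemma cone_inf_lep x : cone_inf p G x <= p x.
Proof.
by case: cG => G0 _ _; have := cone_inf_le x G0; rewrite addr0 subr0.
Qed.

Lemma cone_inf_oppl k : G k -> cone_inf p G (- k.1) <= - k.2.
Proof.
by move=> Gk; have := cone_inf_le (- k.1) Gk; rewrite addNr sublinear0// sub0r.
Qed.

Lemma cone_inf_sublinear : sublinear (cone_inf p G).
Proof.
have [G0 GD GZ] := cG; split => [x y|a x a0].
  rewrite -lerBlDr; apply: le_cone_inf => k Gk.
  rewrite lerBlDr -lerBlDl; apply: le_cone_inf => l Gl.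
  have := cone_inf_le (x + y) (GD _ _ Gk Gl) => /=; rewrite addrACA.
  by have := sp.1 (x + k.1) (y + l.1); lra.
rewrite -ler_pdivrMl//; apply: le_cone_inf => k Gk.
rewrite ler_pdivrMl//; apply: (le_trans (cone_inf_le _ (GZ _ _ a0 Gk))) => /=.
by rewrite -scalerDr sublinearZ// mulrBr.
Qed.

End ConeInf.

(** Zorn's lemma for the reversed pointwise order. Infima along a chain are finite because
    [- p (- x)] bounds all members from below at [x]. *)
Lemma minimal_sublinear p : sublinear p ->
  exists q, [/\ sublinear q, (forall x, q x <= p x) &
    forall q', sublinear q' -> (forall x, q' x <= q x) -> q' = q].
Proof.
move=> sp; pose T := {q : V -> R | sublinear q /\ forall x, q x <= p x}.
pose r (q1 q2 : T) := `[< forall x, sval q2 x <= sval q1 x >].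
have p_in : sublinear p /\ forall x, p x <= p x by split.
have [||||[q [sq qp]] qmin] := @Zorn T r.
- by move=> q; apply/asboolP.
- move=> q1 q2 q3 /asboolP h1 /asboolP h2; apply/asboolP => x.
  exact: le_trans (h2 x) (h1 x).
- move=> [q1 h1] [q2 h2] /asboolP/= h /asboolP/= h'; apply: eq_exist.
  by apply/funext => x; apply/eqP; rewrite eq_le h h'.
- move=> A totA; have [[q0 Aq0]|A0] := pselect (A !=set0); last first.
    by exists (exist _ p p_in) => s As; exfalso; apply: A0; exists s.
  pose S x := [set sval q x | q in A].
  have Slb x : has_lbound (S x).
    exists (- p (- x)) => _ [[q [sq qp]] _ <-]/=.
    by have := sublinear_opp_le x sq; have := qp (- x); lra.
  have Sne x : S x !=set0 by exists (sval q0 x), q0.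
  have inS x (q : T) : A q -> inf (S x) <= sval q x.
    by move=> Aq; apply: ge_inf => //; exists q.
  have sinf : sublinear (fun x => inf (S x)).
    split => [x y|a x a0]; last first.
      rewrite -ler_pdivrMl//; apply: lb_le_inf => // _ [q Aq <-].
      rewrite ler_pdivrMl//; apply: (le_trans (inS _ _ Aq)).
      by case: q {Aq} => q [sq ?] /=; exact: sq.2.
    rewrite -lerBlDr; apply: lb_le_inf => // _ [q1 A1 <-].
    rewrite lerBlDr -lerBlDl; apply: lb_le_inf => // _ [q2 A2 <-].
    (* Subadditivity survives because the smaller of [q1] and [q2] serves at both points. *)
    rewrite lerBlDr; have [/asboolP h|/asboolP h] := totA _ _ A1 A2.
      apply: (le_trans (inS _ _ A2)); have := h x.
      by case: q2 {A2 h} => q [sq ?] /=; have := sq.1 x y; lra.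
    apply: (le_trans (inS _ _ A1)); have := h y.
    by case: q1 {A1 h} => q [sq ?] /=; have := sq.1 x y; lra.
  have infp x : inf (S x) <= p x.
    by apply: (le_trans (inS _ _ Aq0)); case: q0 {Aq0 Sne} => q [] /=.
  exists (exist _ (fun x => inf (S x)) (conj sinf infp) : T) => q Aq; apply/asboolP => x /=.
  exact: inS.
exists q; split=> // q' sq' q'q.
have q'p : forall x, q' x <= p x by move=> x; exact: le_trans (q'q x) (qp x).
suff /qmin/(congr1 sval) :
  r (exist _ q (conj sq qp) : T) (exist _ q' (conj sq' q'p) : T) by [].
exact/asboolP.
Qed.

(** The cone infimum along the ray through [(v, q v)] lies below [q], hence equals it by minimality,
    and its value at [- v] is at most [- q v]. So [q] is odd, and an odd sublinear functional is
    additive. *)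
Lemma minimal_sublinear_linear q : sublinear q ->
  (forall q', sublinear q' -> (forall x, q' x <= q x) -> q' = q) ->
  linear_form q.
Proof.
move=> sq qmin.
have qN v : q (- v) = - q v.
  pose G := ray v (q v).
  have cG : convex_cone G := ray_cone v (q v).
  have Gq k : G k -> k.2 <= q k.1.
    move=> [t + ->]; rewrite le_eqVlt => /predU1P[<-|t0]/=.
      by rewrite scale0r mul0r sublinear0.
    by rewrite sublinearZ.
  have qG := qmin _ (cone_inf_sublinear sq cG Gq) (cone_inf_lep sq cG Gq).
  have Gv : G (v, q v) by exists 1; rewrite ?ler01// scale1r mul1r.
  have := cone_inf_oppl sq Gq Gv; rewrite qG/= => qNv.
  by have := sublinear_opp_le v sq; lra.
have qD x y : q (x + y) = q x + q y.
  have h1 := sq.1 x y; have := sq.1 (x + y) (- y).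
  by rewrite addrK qN lerBrDr => h2; apply/eqP; rewrite eq_le h1 h2.
move=> a x y; rewrite qD; congr (_ + _).
have [a0|a0|->] := ltrgtP a 0; last by rewrite scale0r mul0r sublinear0.
- by rewrite -[a]opprK scaleNr qN sublinearZ ?oppr_gt0//; ring.
- exact: sublinearZ.
Qed.

(* The Mazur-Orlicz form of the Hahn-Banach theorem: it contains both the
   extension of a functional dominated on a subspace and convex separation. *)
Lemma hahn_banach_cone p (G : set (V * R)) : sublinear p -> convex_cone G ->
  (forall k, G k -> k.2 <= p k.1) ->
  exists f, [/\ linear_form f, forall x, f x <= p x &
    forall k, G k -> k.2 <= f k.1].
Proof.
move=> sp cG Gp.
have [f [sf fq fmin]] := minimal_sublinear (cone_inf_sublinear sp cG Gp).
have lf := minimal_sublinear_linear sf fmin.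
exists f; split=> // [x|k Gk].
  exact: le_trans (fq x) (cone_inf_lep sp cG Gp x).
have := le_trans (fq (- k.1)) (cone_inf_oppl sp Gp Gk).
by rewrite linear_formN// lerN2.
Qed.

End HahnBanach.

(** * Sequences in l1 and the dual norm *)

Section Ell1.
Context {R : realType}.
Implicit Types (a b : nat -> R^o) (n N : nat) (C : R).

Lemma cvgn_distP (V : normedModType R) (u : nat -> V) (l : V) :
  u @ \oo --> l <->
  forall eps : R, 0 < eps -> exists N, forall n, (N <= n)%N -> `|u n - l| <= eps.
Proof.
split=> [/cvgrPdist_le h eps e0|h].
  have [N _ hN] := h _ e0; exists N => n Nn; rewrite distrC; exact: hN.
apply/cvgrPdist_le => eps e0; have [N hN] := h _ e0.
by exists N => // n /= Nn; rewrite distrC; exact: hN.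
Qed.

Lemma ler_cvgn (u : nat -> R) (l C : R) N : u @ \oo --> l ->
  (forall n, (N <= n)%N -> u n <= C) -> l <= C.
Proof.
move=> ul uC; rewrite -(cvg_lim (@Rhausdorff R) ul); apply: limr_le.
  by apply/cvg_ex; exists l.
by exists N.
Qed.

Let nneg_series a : nondecreasing_seq (series (fun i => `|a i| : R)).
Proof. exact: (@nondecreasing_series R (fun i => `|a i|) xpredT 0%N). Qed.

Lemma ell1_partial_le a N : ell1 a -> \sum_(0 <= i < N) `|a i| <= ell1_norm a.
Proof. by move=> ?; exact: (nondecreasing_cvgn_le (nneg_series a)). Qed.

Lemma ell1_bounded a C : (forall N, \sum_(0 <= i < N) `|a i| <= C) ->
  ell1 a /\ ell1_norm a <= C.
Proof.
move=> h; have ca : cvgn (series (fun i => `|a i| : R)).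
  by apply: nondecreasing_is_cvgn => //; exists C => _ [N _ <-]; exact: h.
split=> //; apply: limr_le => //; exact: nearW.
Qed.

Lemma series_summable_cvg a (x : nat -> R) (C D : R) :
  (forall N, \sum_(0 <= i < N) `|a i| <= C) -> (forall i, `|x i| <= D) ->
  cvgn (series (fun i => a i * x i : R)).
Proof.
move=> aC xD; apply: normed_cvg; apply: nondecreasing_is_cvgn.
  exact: (@nondecreasing_series R (fun i => `|a i * x i|) xpredT 0%N).
exists (C * D) => _ [N _ <-]; rewrite /series/=.
apply: (@le_trans _ _ (\sum_(0 <= i < N) `|a i| * D)).
  by apply: ler_sum => i _; rewrite normrM ler_wpM2l.
by rewrite -mulr_suml ler_wpM2r// (le_trans _ (xD 0%N)).
Qed.

Lemma sum_delta (c : nat -> R) n N : (n < N)%N ->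
  (forall i, i != n -> c i = 0) -> \sum_(0 <= i < N) c i = c n.
Proof.
move=> nN h; rewrite (bigD1_seq n) ?mem_index_iota ?iota_uniq//=.
by rewrite big1_seq ?addr0// => i /andP[/h].
Qed.

Definition delta n : nat -> R^o := fun i => (i == n)%:R.

Lemma sum_delta_le1 n N : \sum_(0 <= i < N) `|delta n i| <= 1.
Proof.
apply: (@le_trans _ _ (\sum_(0 <= i < (N + n.+1)%N) `|delta n i|)).
  by rewrite [leRHS](big_cat_nat (n := N)) ?leq_addr//= lerDl sumr_ge0.
rewrite (@sum_delta _ n) ?ltn_addl//; last first.
  by move=> i /negPf; rewrite /delta => ->; rewrite normr0.
by rewrite /delta eqxx normr1.
Qed.

Lemma ell1_delta n : ell1 (delta n).
Proof. by have [] := ell1_bounded (sum_delta_le1 n). Qed.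

Lemma ell1_norm_delta n : ell1_norm (delta n) <= 1.
Proof. by have [] := ell1_bounded (sum_delta_le1 n). Qed.

Definition trunc a N : nat -> R^o := fun i => if (i < N)%N then a i else 0.

Lemma truncE a N : trunc a N = \sum_(0 <= i < N) a i *: delta i.
Proof.
apply/funext => k; rewrite fct_sumE /trunc; case: ltnP => h.
  rewrite (@sum_delta (fun i => (a i *: delta i) k) k)// => [|i ik].
    by rewrite /= fctE /delta eqxx /GRing.scale/= mulr1.
  by rewrite fctE /delta eq_sym (negPf ik) scaler0.
rewrite big1_seq// => i /andP[_]; rewrite mem_index_iota => /andP[_ ik].
by rewrite fctE /delta gtn_eqF ?scaler0// (leq_trans ik).
Qed.

Lemma sum_trunc_tail a N M : (N <= M)%N ->
  \sum_(0 <= i < M) `|(a - trunc a N) i| =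
  \sum_(0 <= i < M) `|a i| - \sum_(0 <= i < N) `|a i|.
Proof.
move=> NM; have split_sum (u : nat -> R) := @big_cat_nat _ _ +%R N 0 M xpredT u (leq0n N) NM.
rewrite !split_sum /= big1_seq ?add0r => [|i /andP[_]]; last first.
  by rewrite mem_index_iota => /andP[_ iN]; rewrite !fctE /trunc iN subrr normr0.
rewrite [X in X = _](_ : _ = \sum_(N <= i < M) `|a i|).
  by rewrite addrAC subrr add0r.
apply: eq_big_nat => i /andP[Ni _].
by rewrite !fctE /trunc ltnNge Ni/= subr0.
Qed.

Lemma ell1_tail a N : ell1 a -> ell1 (a - trunc a N) /\
  ell1_norm (a - trunc a N) <= ell1_norm a - \sum_(0 <= i < N) `|a i|.
Proof.
move=> la; apply: ell1_bounded => M.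
apply: (@le_trans _ _ (\sum_(0 <= i < maxn N M) `|(a - trunc a N) i|)).
  by rewrite [leRHS](big_cat_nat (n := M)) ?leq_maxr//= lerDl sumr_ge0.
by rewrite sum_trunc_tail ?leq_maxl// lerD2r ell1_partial_le.
Qed.

Lemma summable_tail a (d : R) :
  (forall N, \sum_(0 <= i < N) `|a i| <= 1) -> 0 < d ->
  exists M, forall N, (M <= N)%N -> \sum_(M <= i < N) `|a i| <= d.
Proof.
move=> a1 d0; have [la _] := ell1_bounded a1.
have /cvgn_distP/(_ d d0)[M hM] := la; exists M => N MN.
have := hM M (leqnn _); rewrite distrC => /(le_trans (ler_norm _)); apply: le_trans.
rewrite lerBrDl; have := ell1_partial_le N la.
by rewrite (@big_cat_nat _ _ +%R M).
Qed.

Lemma coef_le a C n :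
  (forall N, \sum_(0 <= i < N) `|a i| <= C) -> `|a n| <= C.
Proof.
by move=> /(_ n.+1); rewrite big_nat_recr//=; apply: le_trans; rewrite lerDr sumr_ge0.
Qed.

End Ell1.

Section Dual.
Context {R : realType} {X : completeNormedModType R}.
Implicit Types (f g : X -> R^o) (x : X).

Lemma dual_linear_form f : dual f -> linear_form f.
Proof. by move=> [lf _]; exact: lf. Qed.

Lemma bounded_dual f C : linear_form f -> 0 <= C ->
  (forall x, `|f x| <= C * `|x|) -> dual f /\ dual_norm f <= C.
Proof.
move=> lf C0 fC; split.
  split=> // x; apply/cvgrPdist_lt => eps e0.
  near=> y; rewrite -linear_formB//; apply: (le_lt_trans (fC _)).
  rewrite (@le_lt_trans _ _ ((C + 1) * `|x - y|))// ?ler_wpM2r ?lerDl//.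
  rewrite -ltr_pdivlMl ?ltr_wpDl//; near: y.
  by apply: cvgr_dist_lt => //; rewrite mulr_gt0// invr_gt0 ltr_wpDl.
apply: ge_sup; first by exists `|f 0|, 0 => //=; rewrite normr0.
by move=> _ [x /= x1 <-]; rewrite (le_trans (fC _))// ler_piMr.
Unshelve. all: by end_near.
Qed.

(** A real [sup] is an upper bound only for a bounded set. Continuity at 0 gives a radius [d] below
    which [|f| <= 1], hence the bound [d^-1] on the unit ball. *)
Lemma dual_norm_ub f x : dual f -> `|x| <= 1 -> `|f x| <= dual_norm f.
Proof.
move=> df; have lf := dual_linear_form df; case: df => _ cf.
have [d d0 hd] : exists2 d : R, 0 < d & forall y, `|y| <= d -> `|f y| <= 1.
  have /cvgrPdist_le/(_ 1 ltr01)/nbhs_normP[d /= d0 hd] := cf 0.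
  exists (d / 2); first by rewrite divr_gt0.
  move=> y yd; have := hd y; rewrite /ball_/= sub0r normrN linear_form0//.
  rewrite sub0r normrN; apply; apply: (le_lt_trans yd).
  by rewrite ltr_pdivrMr// ltr_pMr// ltr1n.
move=> x1; apply: ub_le_sup; last by exists x.
exists d^-1 => _ [z /= z1 <-].
have := hd (d *: z); rewrite normrZ gtr0_norm// ler_piMr ?(ltW d0)//.
move=> /(_ isT); rewrite linear_formZ// normrM gtr0_norm// mulrC.
by rewrite -ler_pdivlMr// div1r.
Qed.

Lemma dual_norm_ge0 f : dual f -> 0 <= dual_norm f.
Proof. by move=> df; apply: le_trans (@dual_norm_ub f 0 df _); rewrite ?normr0. Qed.

Lemma dual_norm_le f x : dual f -> `|f x| <= dual_norm f * `|x|.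
Proof.
move=> df; have lf := dual_linear_form df.
have [->|x0] := eqVneq x 0; first by rewrite linear_form0// !normr0 mulr0.
have xp : 0 < `|x| by rewrite normr_gt0.
have := @dual_norm_ub f (`|x|^-1 *: x) df.
rewrite normrZ normfV normr_id mulVf ?gt_eqF//.
move=> /(_ (lexx _)); rewrite linear_formZ// normrM normfV normr_id.
by rewrite mulrC ler_pdivrMr.
Qed.

Lemma linear_form_dual f : linear_form f -> (exists C, forall x, `|f x| <= C * `|x|) -> dual f.
Proof.
move=> lf [C fC]; have [|x|] := @bounded_dual f `|C| lf => //.
by rewrite (le_trans (fC x))// ler_wpM2r// ler_norm.
Qed.

End Dual.

(** * The basis functionals of the dual *)

Section Basis.
Context {R : realType} {X : completeNormedModType R}.
Implicit Types (f g : X -> R^o) (x y : X) (n N : nat).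

(** What is retained of the isometry with l1, phrased pointwise on [X] so that the map itself can be
    forgotten: the third clause is norm control of the coefficients, the last one uniqueness of
    expansions. *)
Definition ell1_basis (e : nat -> X -> R) : Prop :=
  [/\ forall n, linear_form (e n),
      forall n x, `|e n x| <= `|x|,
      forall f C, linear_form f -> 0 <= C -> (forall x, `|f x| <= C * `|x|) ->
        exists a : nat -> R^o, (forall N, \sum_(0 <= i < N) `|a i| <= C) /\
          forall x, series (fun i => a i * e i x : R) @ \oo --> (f x : R)
    & forall a : nat -> R^o, ell1 a ->
        (forall x, series (fun i => a i * e i x : R) @ \oo --> (0 : R)) -> a = 0].

Lemma dual_comb f g (a : R) : dual f -> dual g -> dual (a *: f + g).
Proof.
move=> df dg; have lf := dual_linear_form df; have lg := dual_linear_form dg.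
apply: linear_form_dual => [b x y|].
  by rewrite !fctE lf lg /GRing.scale/=; ring.
exists (`|a| * dual_norm f + dual_norm g) => x; rewrite !fctE.
rewrite (le_trans (ler_normD _ _))// mulrDl lerD ?dual_norm_le//.
by rewrite normrM -mulrA ler_wpM2l// dual_norm_le.
Qed.

Lemma dual0 : dual (0 : X -> R^o).
Proof.
apply: linear_form_dual => [a x y|]; last by exists 0 => x; rewrite normr0 mul0r.
by rewrite [RHS]addr0 [RHS]mulr0.
Qed.

Lemma ell1_predual_basis : ell1_predual X -> exists e, ell1_basis e.
Proof.
move=> [T [[Tfun Tinj Tsurj] Tlin Tnorm]].
have T0 : T 0 = 0.
  have := Tlin 1 _ _ dual0 dual0; rewrite scaler0 addr0 scale1r => h.
  by apply: (addrI (T 0)); rewrite addr0 -h.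
have ex n : exists f, dual f /\ T f = delta n.
  by have [f df <-] := Tsurj _ (@ell1_delta R n); exists f.
have [e he] := choice ex.
have de n : dual (e n) := (he n).1.
have Te n : T (e n) = delta n := (he n).2.
have Tsum (a : nat -> R^o) N : dual (\sum_(0 <= i < N) a i *: e i) /\
    T (\sum_(0 <= i < N) a i *: e i) = trunc a N.
  rewrite truncE; elim: N => [|N [dN TN]].
    by rewrite !big_geq//; split=> //; exact: dual0.
  rewrite !big_nat_recr//= [X in dual X]addrC [X in T X]addrC.
  by split; [exact: dual_comb|rewrite Tlin// TN Te addrC].
(* By the isometry, the error of a partial sum has the norm of an l1 tail of [a]. *)
have rep (a : nat -> R^o) f x : dual f -> T f = a ->
    series (fun i => a i * e i x : R) @ \oo --> (f x : R).
  move=> df Tf; have la : ell1 a by rewrite -Tf; apply: Tfun.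
  apply/cvgn_distP => eps e0.
  have x1 : 0 < `|x| + 1 by rewrite ltr_wpDl.
  have /cvgn_distP/(_ (eps / (`|x| + 1))) [|N hN] := la; first exact: divr_gt0.
  exists N => n /hN {}hN.
  have [dn Tn] := Tsum a n.
  have dg : dual (f - \sum_(0 <= i < n) a i *: e i).
    by rewrite addrC -scaleN1r; exact: dual_comb.
  have Tg : T (f - \sum_(0 <= i < n) a i *: e i) = a - trunc a n.
    by rewrite addrC -scaleN1r Tlin// Tf Tn scaleN1r addrC.
  have := dual_norm_le x dg; rewrite -Tnorm// Tg => h.
  have [_ tl] := ell1_tail n la.
  have tl' : ell1_norm (a - trunc a n) <= eps / (`|x| + 1).
    apply: (le_trans tl); apply: le_trans hN; rewrite distrC; exact: ler_norm.
  have -> : series (fun i => a i * e i x : R) n - f x =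
      - ((f - \sum_(0 <= i < n) a i *: e i) x).
    rewrite !fctE opprB fct_sumE; congr (_ - _); exact: eq_bigr.
  rewrite normrN; apply: (le_trans h).
  apply: (@le_trans _ _ (eps / (`|x| + 1) * `|x|)); first by rewrite ler_wpM2r.
  by rewrite mulrAC ler_pdivrMr// ler_wpM2l ?(ltW e0)// lerDl.
exists e; split.
- by move=> n; exact: dual_linear_form.
- move=> n x; rewrite (le_trans (dual_norm_le x (de n)))// ler_piMl//.
  by rewrite -Tnorm// Te ell1_norm_delta.
- move=> f C lf C0 fC; have [df nf] := bounded_dual lf C0 fC.
  exists (T f); split => [N|x]; last exact: rep.
  by apply: le_trans nf; rewrite -Tnorm//; apply: ell1_partial_le; exact: Tfun.
- move=> a la a0; have [f df Tf] := Tsurj _ la.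
  rewrite -Tf -T0; congr T; apply/funext => x.
  exact: (cvg_unique (@Rhausdorff R) (rep _ _ x df Tf) (a0 x)).
Qed.

Section BasisTheory.
Variables (e : nat -> X -> R).
Hypothesis he : ell1_basis e.

Lemma basis_linear n : linear_form (e n). Proof. by case: he. Qed.

Lemma basis_le n x : `|e n x| <= `|x|. Proof. by case: he. Qed.

Lemma basis_rep f C : linear_form f -> 0 <= C -> (forall x, `|f x| <= C * `|x|) ->
  exists a : nat -> R^o, (forall N, \sum_(0 <= i < N) `|a i| <= C) /\
    forall x, series (fun i => a i * e i x : R) @ \oo --> (f x : R).
Proof. by case: he => _ _ + _; exact. Qed.

Lemma basis_uniq (a : nat -> R^o) : ell1 a ->
  (forall x, series (fun i => a i * e i x : R) @ \oo --> (0 : R)) -> a = 0.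
Proof. by case: he => _ _ _; exact. Qed.

Lemma delta_series n x :
  series (fun i => delta n i * e i x : R) @ \oo --> (e n x : R).
Proof.
apply/cvgn_distP => eps e0; exists n.+1 => N nN.
rewrite /series/= (@sum_delta _ _ n)//; first by rewrite /delta eqxx mul1r subrr normr0 ltW.
by move=> i /negPf; rewrite /delta => ->; rewrite mul0r.
Qed.

Lemma basis_inj n m (s t : R) : (forall x, s * e n x = t * e m x) ->
  s * delta n m = t.
Proof.
move=> h.
have la : ell1 (s *: delta n - t *: delta m : nat -> R^o).
  apply: (proj1 (@ell1_bounded R (s *: delta n - t *: delta m) (`|s| + `|t|) _)).
  move=> N; apply: (@le_trans _ _ (\sum_(0 <= i < N) (`|s| * `|delta n i| + `|t| * `|delta m i|))).
    by apply: ler_sum => i _; rewrite !fctE (le_trans (ler_normB _ _))// !normrM.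
  rewrite big_split/= -!mulr_sumr.
  by rewrite lerD// ler_piMr// sum_delta_le1.
have : (s *: delta n - t *: delta m : nat -> R^o) m = 0.
  rewrite (basis_uniq la)// => x.
  have -> : (series (fun i => (s *: delta n - t *: delta m : nat -> R^o) i * e i x) : nat -> R) =
      (fun N => s * series (fun i => delta n i * e i x : R) N -
        t * series (fun i => delta m i * e i x : R) N).
    apply/funext => N; rewrite /series/= !mulr_sumr -sumrB.
    by apply: eq_bigr => i _; rewrite !fctE /GRing.scale/=; ring.
  rewrite -(subrr (t * e m x)) -{1}h.
  by apply: cvgB; apply: cvgMr; exact: delta_series.
change (s * delta n m - t * delta m m = 0 -> s * delta n m = t).
by rewrite [delta m m]/delta eqxx mulr1 => /eqP; rewrite subr_eq0 => /eqP.
Qed.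

(** A Hahn-Banach functional norming [x] is an l1 combination of the [e n] of total mass at most
    1. *)
Lemma norm_le_basis x C : (forall n, `|e n x| <= C) -> `|x| <= C.
Proof.
move=> eC; pose G := ray x `|x|.
have [f [lf fn fG]] : exists f, [/\ linear_form f, forall y, f y <= `|y| &
    forall k, G k -> k.2 <= f k.1].
  apply: hahn_banach_cone.
  - split=> [u v|a u a0]; [exact: ler_normD|by rewrite normrZ gtr0_norm].
  - exact: ray_cone.
  - by move=> _ [t t0 ->]/=; rewrite normrZ ger0_norm.
have fx : `|x| <= f x by apply: (fG (x, `|x|)); exists 1; rewrite ?scale1r ?mul1r.
have fb y : `|f y| <= 1 * `|y|.
  by rewrite mul1r ler_norml fn -(normrN y) andbT lerNl -linear_formN.
have [a [a1 ax]] := basis_rep lf ler01 fb.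
apply: (le_trans fx); apply: (ler_cvgn (N := 0) (ax x)) => N _.
have C0 : 0 <= C by apply: le_trans (eC 0%N).
apply: (@le_trans _ _ (\sum_(0 <= i < N) `|a i| * C)).
  apply: ler_sum => i _; apply: (le_trans (ler_norm _)).
  by rewrite normrM ler_wpM2l.
by rewrite -mulr_suml ler_piMl.
Qed.

End BasisTheory.
End Basis.

(** * Interpolation in a predual of l1 *)

Lemma cvgn_sum (R : realType) (I : Type) (r : seq I) (u : I -> nat -> R) (l : I -> R) :
  (forall i, u i @ \oo --> l i) ->
  (fun n => \sum_(i <- r) u i n) @ \oo --> \sum_(i <- r) l i.
Proof.
move=> ul; elim: r => [|i r IH].
  rewrite big_nil [X in X @ _](_ : _ = cst 0); first exact: cvg_cst.
  by apply/funext => n; rewrite big_nil.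
rewrite big_cons [X in X @ _](_ : _ = u i \+ (fun n => \sum_(i <- r) u i n)).
  exact: cvgD.
by apply/funext => n; rewrite big_cons.
Qed.

Lemma bigmax_sublinear (R : realType) (V : lmodType R) (K : finType)
    (N : K -> V -> R) : (forall k, sublinear (N k)) ->
  sublinear (fun v => \big[Num.max/0]_k N k v).
Proof.
move=> sN; split=> [x y|a x a0].
  apply: bigmax_le => [|k _].
    by apply: addr_ge0; exact: bigmax_ge_id.
  apply: (le_trans ((sN k).1 x y)); apply: lerD;
    [exact: (le_bigmax _ (fun k => N k x))|exact: (le_bigmax _ (fun k => N k y))].
apply: bigmax_le => [|k _].
  by rewrite mulr_ge0 ?(ltW a0)//; exact: bigmax_ge_id.
apply: (le_trans ((sN k).2 a x a0)); rewrite ler_pM2l//.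
exact: (le_bigmax _ (fun k => N k x)).
Qed.

Lemma dual_norm_approx (R : realType) (X : completeNormedModType R)
    (f : X -> R^o) (eta : R) : dual f -> 0 < eta ->
  exists x, `|x| <= 1 /\ dual_norm f - eta <= f x.
Proof.
move=> df eta0; have lf := dual_linear_form df.
have hs : has_sup [set `|f x| | x in [set x : X | `|x| <= 1]].
  split; first by exists `|f 0|, 0 => //=; rewrite normr0.
  by exists (dual_norm f) => _ [x /= x1 <-]; exact: dual_norm_ub.
have [_ [x /= x1 <-] h] := sup_adherent eta0 hs.
have [fx|fx] := leP 0 (f x).
  by exists x; split=> //; rewrite -(ger0_norm fx) ltW.
exists (- x); rewrite normrN; split=> //.
have -> : f (- x) = `|f x| by rewrite (linear_formN _ lf) ltr0_norm.
exact: ltW.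
Qed.

Section Interpolation.
Context {R : realType} {X : completeNormedModType R} (e : nat -> X -> R).
Hypothesis he : ell1_basis e.

Section Product.
Variables (I : finType) (f : (I -> X) * (nat -> R^o) -> R).
Hypothesis lf : linear_form f.

Definition comp_form (i : I) (x : X) : R :=
  f ((fun j => if j == i then x else 0) : I -> X, 0 : nat -> R^o).

Definition comp_coef (l : nat) : R^o := f (0 : I -> X, delta l).

Lemma comp_form_linear i : linear_form (comp_form i).
Proof.
move=> a x y; rewrite /comp_form -lf; congr f; congr pair.
  apply/funext => j; rewrite [RHS](_ : _ = a *: (if j == i then x else 0) +
    (if j == i then y else 0))//.
  by case: ifP => // _; rewrite scaler0 addr0.
by rewrite /= scaler0 addr0.
Qed.

(** [f] is merely algebraic on the second factor, so only finitely supported sequences can be split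
    into unit vectors. *)
Lemma comp_formE (w : I -> X) (s : nat -> R^o) M :
  f (w, trunc s M) = \sum_i comp_form i (w i) + \sum_(0 <= l < M) s l * comp_coef l.
Proof.
rewrite -[\sum_i _](linear_form_sum _ _ _ lf).
under [in X in _ + X]eq_bigr => l _ do rewrite -(linear_formZ _ _ lf).
rewrite -(linear_form_sum _ _ _ lf) -linear_formD//; congr f.
rewrite [RHS]surjective_pairing; congr pair => /=.
  rewrite !(big_morph (@fst _ _) (fun _ _ => erefl) erefl)/=.
  rewrite [X in _ + X]big1 ?addr0; last by move=> ? _; rewrite scaler0.
  apply/funext => j; rewrite fct_sumE (bigD1 j)//= eqxx big1 ?addr0// => i ij.
  by rewrite eq_sym (negPf ij).
rewrite !(big_morph (@snd _ _) (fun _ _ => erefl) erefl)/= big1_eq add0r.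
exact: truncE.
Qed.

End Product.

(* [t] is an element of the bidual [l_oo] lying in all the balls.  If no [p] does
   up to [eps], the Mazur-Orlicz theorem on X^I * R^nat gives functionals [F i] of
   X whose sum is a combination of [e 0, ..., e (M-1)]; comparing coefficients
   turns the separation into [1 <= sum_i r i * |F i|], whereas
   [sum_i (r i + eps) * |F i| <= 1]. *)
Lemma approx_interpolation (I : finType) (c : I -> X) (r : I -> R) (t : nat -> R)
    (M : nat) (eps : R) : 0 < eps ->
  (forall i n, `|t n - e n (c i)| <= r i) ->
  exists p, (forall i, `|p - c i| <= r i + eps) /\
    forall l, (l < M)%N -> `|e l p - t l| <= eps.
Proof.
move=> eps0 tc; apply: contrapT => /forallNP nop.
have r0 i : 0 <= r i by apply: le_trans (tc i 0%N).
have re i : 0 < r i + eps by rewrite ltr_wpDl.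
pose V := ((I -> X) * (nat -> R^o))%type.
(* Gauges of the constraints: a maximum at most 1 on the differences [p - c i] and [e l p - t l]
   means that [p] is admissible. *)
pose N (k : I + 'I_M) (v : V) : R :=
  match k with inl i => `|v.1 i| / (r i + eps) | inr l => `|v.2 l| / eps end.
have sN k : sublinear (N k).
  case: k => k; split=> /= [x y|a x a0].
  - by rewrite -mulrDl ler_wpM2r ?invr_ge0 ?ler_normD// ltW.
  - by rewrite normrZ gtr0_norm// mulrA.
  - by rewrite -mulrDl ler_wpM2r ?invr_ge0 ?ler_normD// ltW.
  - by rewrite normrM gtr0_norm// mulrA.
pose q v := \big[Num.max/0]_k N k v.
have sq : sublinear q := bigmax_sublinear sN.
(* Homogenised constraints: for [lam > 0], [q (w lam y) < lam] would make [lam^-1 *: y] admissible,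
   against [nop]. For [lam = 0] these vectors form a subspace, on which [f] must vanish. *)
pose w (lam : R) (y : X) : V := ((fun i => y - lam *: c i) : I -> X,
  trunc (fun l => e l y - lam * t l) M).
pose G : set (V * R) := [set k | exists lam y, 0 <= lam /\ k = (w lam y, lam)].
have lin_e n := basis_linear he n.
have wD l1 l2 y1 y2 : w l1 y1 + w l2 y2 = w (l1 + l2) (y1 + y2).
  congr pair; first by apply/funext => i /=; rewrite [LHS]addrACA scalerDl opprD.
  apply/funext => l; rewrite [LHS](_ : _ =
    trunc (fun l => e l y1 - l1 * t l) M l + trunc (fun l => e l y2 - l2 * t l) M l)//.
  by rewrite /trunc; case: ifP => _; rewrite ?addr0// (linear_formD _ _ (lin_e l)); ring.
have wZ a l1 y1 : a *: w l1 y1 = w (a * l1) (a *: y1).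
  congr pair; first by apply/funext => i /=; rewrite [LHS]scalerBr scalerA.
  apply/funext => l; rewrite [LHS](_ : _ = a * trunc (fun l => e l y1 - l1 * t l) M l)//.
  by rewrite /trunc; case: ifP => _; rewrite ?mulr0// (linear_formZ _ _ (lin_e l)); ring.
have cG : convex_cone G.
  split.
  - exists 0, 0; split=> //; congr pair; rewrite /w; congr pair.
      by apply/funext => i; rewrite scale0r subrr.
    by apply/funext => l; rewrite /trunc mul0r subr0 linear_form0//; case: ifP.
  - move=> _ _ [l1 [y1 [l10 ->]]] [l2 [y2 [l20 ->]]].
    by exists (l1 + l2), (y1 + y2); rewrite addr_ge0// -wD.
  - move=> a _ a0 [l1 [y1 [l10 ->]]].
    by exists (a * l1), (a *: y1); rewrite mulr_ge0 ?(ltW a0)// -wZ.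
have Gq k : G k -> k.2 <= q k.1.
  move=> [lam [y [lam0 ->]]] /=; rewrite leNgt; apply/negP => ql.
  have lamp : 0 < lam by apply: le_lt_trans ql; exact: bigmax_ge_id.
  have Nl k' : N k' (w lam y) < lam.
    by apply: le_lt_trans ql; exact: (le_bigmax _ (fun k => N k (w lam y))).
  apply: (nop (lam^-1 *: y)); split=> [i|l lM].
    have := Nl (inl i); rewrite /= ltr_pdivrMr// -ltr_pdivrMl// => /ltW.
    rewrite -[X in X * _](gtr0_norm (x := lam^-1)) ?invr_gt0// -normrZ scalerBr.
    by rewrite scalerA mulVf ?gt_eqF// scale1r.
  have := Nl (inr (Ordinal lM)); rewrite /= /trunc lM ltr_pdivrMr// -ltr_pdivrMl// => /ltW.
  rewrite -[X in X * _](gtr0_norm (x := lam^-1)) ?invr_gt0// -normrM mulrBr.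
  by rewrite mulrA mulVf ?gt_eqF// mul1r linear_formZ.
have [f [lf fq fG]] := hahn_banach_cone sq cG Gq.
have fy y : f (w 0 y) = 0.
  have h y' : 0 <= f (w 0 y') by apply: (fG (w 0 y', 0)); exists 0, y'.
  have := h (- y); have -> : w 0 (- y) = - w 0 y.
    by rewrite -(scaleN1r y) -(scaleN1r (w _ _)) wZ mulr0.
  by rewrite linear_formN// oppr_ge0 => h'; apply/eqP; rewrite eq_le h h'.
pose F i := comp_form f i; pose lam := comp_coef f.
have lF i : linear_form (F i) := comp_form_linear lf i.
have Fle i x : F i x <= (r i + eps)^-1 * `|x|.
  rewrite mulrC; apply: (le_trans (fq _)); apply: bigmax_le => [|[j|j] _] /=.
  - by rewrite mulr_ge0// invr_ge0 ltW.
  - case: eqP => [->//|_]; rewrite normr0 mul0r mulr_ge0// invr_ge0 ltW//.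
  - by rewrite normr0 mul0r mulr_ge0// invr_ge0 ltW.
have dF i : dual (F i).
  apply: linear_form_dual => //; exists (r i + eps)^-1 => x.
  rewrite ler_norml Fle andbT lerNl -linear_formN//.
  by rewrite (le_trans (Fle _ _))// normrN.
pose A i := dual_norm (F i).
have A0 i : 0 <= A i := dual_norm_ge0 (dF i).
have /choice[a ha] i : exists a : nat -> R^o,
    (forall N, \sum_(0 <= n < N) `|a n| <= A i) /\
    forall x, series (fun n => a n * e n x : R) @ \oo --> (F i x : R).
  by apply: (basis_rep he (lF i) (A0 i)) => x; exact: dual_norm_le.
(* The coefficients of [\sum_i F i] plus the combination of [e 0, ..., e (M-1)] given by [lam]; this
   functional is zero by [fy]. *)
pose b n : R^o := \sum_i a i n + trunc lam M n.
have trunc_sum (u : nat -> R) (v : nat -> R^o) n : (M <= n)%N ->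
    \sum_(0 <= i < n) trunc v M i * u i = \sum_(0 <= i < M) v i * u i.
  move=> Mn; rewrite (@big_cat_nat _ _ +%R M)//= [X in _ + X]big1_seq ?addr0.
    by apply: eq_big_nat => i /andP[_ iM]; rewrite /trunc iM.
  by move=> i /andP[_]; rewrite mem_index_iota => /andP[Mi _]; rewrite /trunc ltnNge Mi mul0r.
have b0 : b = 0.
  apply: (basis_uniq he).
    apply: (proj1 (@ell1_bounded R b (\sum_i A i + \sum_(0 <= l < M) `|lam l|) _)).
    move=> n; apply: (@le_trans _ _ (\sum_(0 <= k < n) (\sum_i `|a i k| + `|trunc lam M k|))).
      apply: ler_sum => k _; rewrite (le_trans (ler_normD _ _))// lerD2r.
      exact: ler_norm_sum.
    rewrite big_split/= exchange_big/=; apply: lerD.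
      by apply: ler_sum => i _; exact: (ha i).1.
    apply: (@le_trans _ _ (\sum_(0 <= k < maxn M n) `|trunc lam M k|)).
      by rewrite [leRHS](@big_cat_nat _ _ +%R n)//= ?leq_maxr// lerDl sumr_ge0.
    have <- : \sum_(0 <= k < maxn M n) trunc (fun l => `|lam l|) M k * 1 =
        \sum_(0 <= l < M) `|lam l|.
      by rewrite (trunc_sum (fun=> 1)) ?leq_maxl//; apply: eq_bigr => i _; rewrite mulr1.
    by apply: ler_sum => i _; rewrite mulr1 /trunc; case: ifP => // _; rewrite normr0.
  move=> x.
  have S0 : \sum_i F i x + \sum_(0 <= l < M) lam l * e l x = 0.
    apply: etrans (fy x); rewrite /w comp_formE//; congr (_ + _); apply: eq_bigr => i _.
      by rewrite scale0r subr0.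
    by rewrite mul0r subr0 mulrC.
  rewrite -[X in _ --> X]S0 [X in X @ _](_ : _ =
     (fun n => \sum_i series (fun k => a i k * e k x : R) n) \+
     (fun n => \sum_(0 <= k < n) trunc lam M k * e k x)); last first.
    apply/funext => n; rewrite /series/= exchange_big/= -big_split/=; apply: eq_bigr => k _.
    by rewrite /b mulrDl mulr_suml.
  apply: cvgD; first by apply: cvgn_sum => i; exact: (ha i).2.
  apply/cvgn_distP => eta eta0; exists M => n Mn.
  by rewrite trunc_sum// subrr normr0 ltW.
have f1 : 1 <= \sum_i F i (- c i) - \sum_(0 <= l < M) t l * lam l.
  have := fG (w 1 0, 1); rewrite /= /w comp_formE// => h; apply: le_trans (h _) _.
    by exists 1, 0.
  rewrite le_eqVlt; apply/orP; left; apply/eqP; congr (_ + _).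
    by apply: eq_bigr => i _; rewrite scale1r sub0r.
  by rewrite -sumrN; apply: eq_bigr => l _; rewrite linear_form0// mul1r sub0r mulNr.
(* Since [b = 0], the left side is the limit of the sums of [a i k * (t k - e k (c i))], where each
   difference is at most [r i]. *)
have f2 : \sum_i F i (- c i) - \sum_(0 <= l < M) t l * lam l <= \sum_i r i * A i.
  have cv : (fun n => \sum_i series (fun k => a i k * e k (- c i) : R) n -
      \sum_(0 <= l < M) t l * lam l) @ \oo -->
      \sum_i F i (- c i) - \sum_(0 <= l < M) t l * lam l.
    by apply: cvgB; [apply: cvgn_sum => i; exact: (ha i).2|exact: cvg_cst].
  apply: (ler_cvgn (N := M) cv) => n Mn.
  have -> : \sum_(0 <= l < M) t l * lam l = - \sum_i \sum_(0 <= k < n) a i k * t k.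
    under eq_bigr do rewrite mulrC.
    rewrite -(trunc_sum t lam n Mn) exchange_big/= -sumrN; apply: eq_bigr => k _.
    have /eqP : b k = 0 by rewrite b0.
    by rewrite /b addrC addr_eq0 => /eqP ->; rewrite -mulr_suml mulNr.
  rewrite opprK -big_split/=; apply: ler_sum => i _.
  rewrite -big_split/=; apply: (@le_trans _ _ (\sum_(0 <= k < n) `|a i k| * r i)).
    apply: ler_sum => k _; rewrite -mulrDr linear_formN// addrC.
    by rewrite (le_trans (ler_norm _))// normrM ler_wpM2l.
  by rewrite -mulr_suml mulrC ler_wpM2l// (ha i).1.
(* [f <= q] is tested on the components [(r i + eps) *: x i], with [x i] almost norming [F i]; the
   gauge of this vector is at most 1. *)
have f3 : \sum_i (r i + eps) * A i <= 1.
  pose rho := \sum_i (r i + eps).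
  have rho0 : 0 <= rho by apply: sumr_ge0 => i _; exact: ltW.
  apply/ler_addgt0Pr => d d0.
  have eta0 : 0 < d / (rho + 1) by rewrite divr_gt0// ltr_wpDl.
  have /choice[x hx] i : exists x, `|x| <= 1 /\ A i - d / (rho + 1) <= F i x.
    exact: dual_norm_approx.
  have : f ((fun i => (r i + eps) *: x i) : I -> X, trunc 0 M) <= 1.
    apply: (le_trans (fq _)); apply: bigmax_le => // -[i|l] _ /=.
      by rewrite normrZ gtr0_norm// mulrAC mulfV ?gt_eqF// mul1r; exact: (hx i).1.
    by rewrite /trunc; case: ifP => _; rewrite normr0 mul0r.
  rewrite comp_formE// [X in _ + X]big1 ?addr0; last by move=> ? _; rewrite mul0r.
  move=> h; apply: (@le_trans _ _ (\sum_i ((r i + eps) * F i (x i) +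
    (r i + eps) * (d / (rho + 1))))).
    apply: ler_sum => i _; rewrite -mulrDr ler_pM2l// -lerBlDr; exact: (hx i).2.
  rewrite big_split/= -mulr_suml -/rho; apply: lerD.
    by apply: le_trans h; apply: ler_sum => i _; rewrite linear_formZ.
  by rewrite mulrCA ler_piMr ?(ltW d0)// ler_pdivrMr ?ltr_wpDl// mul1r lerDl.
have : eps * \sum_i A i <= 0.
  move: f3; under eq_bigr do rewrite mulrDl.
  by rewrite big_split/= -mulr_sumr; have := le_trans f1 f2; lra.
rewrite pmulr_rle0// => sA.
have A00 i : A i = 0.
  apply/eqP; rewrite eq_le A0 andbT; apply: le_trans sA.
  by rewrite (bigD1 i)//= lerDl sumr_ge0.
have := le_trans f1 f2; rewrite big1 ?ler10//.
by move=> i _; rewrite A00 mulr0.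
Qed.

End Interpolation.

(** * Exact interpolation and the addition of one dimension *)

Section Exact.
Context {R : realType} {X : completeNormedModType R} (e : nat -> X -> R).
Hypothesis he : ell1_basis e.

Lemma cvgn_cauchy (u : nat -> X) :
  (forall eps : R, 0 < eps -> exists N, forall n, (N <= n)%N -> `|u n - u N| <= eps) ->
  cvgn u.
Proof.
move=> h; apply: cauchy_cvg; apply: cauchy_exP => eps /= eps0.
have [|N hN] := h (eps / 2); first by rewrite divr_gt0.
exists (u N), N => // n /= Nn; rewrite -ball_normE/= distrC.
apply: (le_lt_trans (hN _ Nn)).
by rewrite ltr_pdivrMr// ltr_pMr// ltr1n.
Qed.

Lemma half_expn_small (eps : R) : 0 < eps -> exists N, forall n, (N <= n)%N -> 2^-1 ^+ n <= eps.
Proof.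
move=> eps0; have [N _ hN] := near_infty_natSinv_expn_lt (PosNum eps0).
by exists N => n /hN /=; rewrite div1r exprVn => /ltW.
Qed.

Lemma geometric_cauchy (u : nat -> X) (C : R) :
  (forall k, `|u k.+1 - u k| <= C * 2^-1 ^+ k) -> cvgn u.
Proof.
move=> h; have C0 : 0 <= C by have := le_trans (normr_ge0 _) (h 0%N); rewrite mulr1.
have hd m k : `|u (m + k)%N - u m| <= 2 * C * (2^-1 ^+ m - 2^-1 ^+ (m + k)).
  elim: k => [|k IH]; first by rewrite addn0 !subrr normr0 mulr0.
  rewrite addnS; have := h (m + k)%N.
  have := ler_distD (u (m + k)%N) (u (m + k).+1) (u m).
  rewrite exprS; move: IH; set x := _ ^+ (m + k).
  by move=> *; lra.
apply: cvgn_cauchy => eps eps0.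
have [|N hN] := @half_expn_small (eps / (2 * C + 1)).
  by rewrite divr_gt0// ltr_wpDl// mulr_ge0.
exists N => n Nn; rewrite -(subnKC Nn); apply: (le_trans (hd _ _)).
have x0 : 0 <= 2^-1 ^+ (N + (n - N)) :> R by rewrite exprn_ge0.
have := hN N (leqnn _); rewrite ler_pdivlMr ?ltr_wpDl ?mulr_ge0//.
have y0 : 0 <= 2^-1 ^+ N :> R by rewrite exprn_ge0.
by have := mulr_ge0 C0 x0; move: (2^-1 ^+ N) (2^-1 ^+ _) x0 y0 => y x *; lra.
Qed.

(** The point of [[s - eps, s + eps]] nearest to [t]. *)
Definition move_toward (eps t s : R) : R :=
  if `|t - s| <= eps then t else if s < t then s + eps else s - eps.

Lemma move_toward_dist eps t s : 0 < eps -> `|move_toward eps t s - s| <= eps.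
Proof.
move=> e0; rewrite /move_toward; case: ifP => // _; case: ifP => _.
  by rewrite addrAC subrr add0r gtr0_norm.
by rewrite addrAC subrr add0r normrN gtr0_norm.
Qed.

(** [s] lies outside the ball by at most [eps], and it either reaches the point [t] of the ball or
    moves by [eps] towards it. *)
Lemma move_toward_ball eps t s c r : `|t - c| <= r -> `|s - c| <= r + eps ->
  `|move_toward eps t s - c| <= r.
Proof.
rewrite /move_toward; case: ifPn => //; rewrite -ltNge => h tc sc.
have [st|ts] := ltP s t.
  have : t - s > eps by rewrite -(gtr0_norm (x := t - s)) ?subr_gt0.
  move: tc sc; rewrite !ler_norml => /andP[? ?] /andP[? ?] ?.
  by apply/andP; split; lra.
have : s - t > eps by rewrite -(ger0_norm (x := s - t)) ?subr_ge0// distrC.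
move: tc sc; rewrite !ler_norml => /andP[? ?] /andP[? ?] ?.
by apply/andP; split; lra.
Qed.

(* Each correction moves the bidual target [t] towards the current approximation,
   which stays in all the balls, and adds a ball around that approximation, so that
   the successive approximations converge. *)
Lemma exact_interpolation (I : finType) (c : I -> X) (r : I -> R) (t : nat -> R)
    (M : nat) : (forall i n, `|t n - e n (c i)| <= r i) ->
  exists p, (forall i, `|p - c i| <= r i) /\ forall l, (l < M)%N -> e l p = t l.
Proof.
move=> tc; have lin_e n := basis_linear he n.
pose eps k : R := 2^-1 ^+ k.
have eps0 k : 0 < eps k by rewrite exprn_gt0.
pose good k p := (forall i, `|p - c i| <= r i + eps k) /\
    forall l, (l < M)%N -> `|e l p - t l| <= eps k.
have step k p : good k p -> exists p', good k.+1 p' /\ `|p' - p| <= 2 * eps k.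
  move=> [pc pt].
  pose c' (i : option I) := if i is Some j then c j else p.
  pose r' (i : option I) := if i is Some j then r j else eps k.
  pose t' n := move_toward (eps k) (t n) (e n p).
  have [|p' [p'c p't]] := @approx_interpolation _ _ _ he _ c' r' t' M _ (eps0 k.+1).
    move=> [i|] n /=; last exact: move_toward_dist.
    apply: move_toward_ball => //; rewrite -linear_formB//.
    exact: le_trans (basis_le he _ _) (pc i).
  exists p'; split; first split=> [i|l lM]; first exact: (p'c (Some i)).
    (* A prescribed coordinate is already within [eps k] of its target, so the target does not
       move. *)
    have <- : t' l = t l by rewrite /t' /move_toward distrC pt.
    exact: p't.
  have := p'c None; rewrite /= => /le_trans; apply.
  have : eps k.+1 <= eps k.
    rewrite /eps exprS; have := eps0 k; rewrite /eps; move: (2^-1 ^+ k) => x; lra.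
  by lra.
have [p0 good0] : exists p, good 0%N p by exact: (approx_interpolation he).
have /choice[next hnext] (kp : nat * X) : exists p', good kp.1 kp.2 ->
    good kp.1.+1 p' /\ `|p' - kp.2| <= 2 * eps kp.1.
  case: kp => k p /=.
  have [/step[p' ?]|np] := pselect (good k p); first by exists p'.
  by exists p.
pose u := fix u k := if k is k'.+1 then next (k', u k') else p0.
have good_u k : good k (u k).
  by elim: k => [//|k IH] /=; exact: (hnext (k, u k) IH).1.
have cu : cvgn u.
  by apply: (@geometric_cauchy _ 2) => k; exact: (hnext (k, u k) (good_u k)).2.
set p := lim (u @ \oo) in cu.
exists p; split=> [i|l lM].
  apply/ler_addgt0Pr => d d0.
have d20 : 0 < d / 2 by rewrite divr_gt0.
  have [N1 hN1] := (cvgn_distP _ _).1 cu (d / 2) d20.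
  have [N2 hN2] := half_expn_small d20.
  have [+ _] := good_u (maxn N1 N2) => /(_ i).
  have := hN1 _ (leq_maxl N1 N2); have := hN2 _ (leq_maxr N1 N2).
  have := ler_distD (u (maxn N1 N2)) p (c i); rewrite [`|p - u _|]distrC /eps.
  by move=> *; lra.
apply/eqP; rewrite -subr_eq0 -normr_le0; apply/ler_addgt0Pr => d d0.
have d20 : 0 < d / 2 by rewrite divr_gt0.
have [N1 hN1] := (cvgn_distP _ _).1 cu (d / 2) d20.
have [N2 hN2] := half_expn_small d20.
have [_ /(_ l lM)] := good_u (maxn N1 N2).
have := hN1 _ (leq_maxl N1 N2); have := hN2 _ (leq_maxr N1 N2).
have := basis_le he l (u (maxn N1 N2) - p); rewrite linear_formB//.
have := ler_distD (e l (u (maxn N1 N2))) (e l p) (t l).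
rewrite [`|e l p - e l (u _)|]distrC /eps add0r.
by move=> *; lra.
Qed.

(* The last conclusion amounts to the finitely many ball constraints
   [`|w sigma + c sigma *: p| <= 1] indexed by signs, which [s *: delta n] satisfies
   in the bidual. *)
Lemma extension_step (m n : nat) (v : nat -> X) (s : R) : `|s| = 1 ->
  (forall k, \sum_(j < m) `|e k (v j)| <= 1) ->
  exists p, [/\ forall k, (k < n)%N -> e k p = 0, e n p = s &
    forall k, \sum_(j < m) `|e k (v j - (s * e n (v j)) *: p)| + `|e k p| <= 1].
Proof.
move=> s1 v1; have lin_e k := basis_linear he k.
have ss : s * s = 1 by rewrite -expr2 -real_normK ?num_real// s1 expr1n.
pose sg (sigma : {ffun 'I_m -> bool}) (j : 'I_m) : R := (-1) ^+ sigma j.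
pose w sigma := \sum_(j < m) sg sigma j *: v j.
pose c sigma := 1 - \sum_(j < m) sg sigma j * (s * e n (v j)).
have ew k sigma : e k (w sigma) = \sum_(j < m) sg sigma j * e k (v j).
  by rewrite linear_form_sum//; apply: eq_bigr => j _; rewrite linear_formZ.
have sum1 k sigma : `|e k (w sigma)| <= 1.
  rewrite ew (le_trans (ler_norm_sum _ _ _))//; apply: le_trans (v1 k).
  by apply: ler_sum => j _; rewrite normrM normr_sign mul1r.
(* So [s * e n] takes the value 1 at [w sigma + c sigma *: p] as soon as [e n p = s]. *)
have cE sigma : c sigma = 1 - s * e n (w sigma).
  by rewrite ew mulr_sumr; congr (1 - _); apply: eq_bigr => j _; rewrite mulrCA.
have c0 sigma : 0 <= c sigma.
  rewrite cE subr_ge0 (le_trans (ler_norm _))// normrM s1 mul1r//.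
pose t k : R := if k == n then s else 0.
(* If [c sigma = 0] the constraint does not involve [p]; as [0^-1 = 0], the ball is then the unit
   ball, which contains [t]. *)
pose r sigma := if c sigma == 0 then 1 else (c sigma)^-1.
have [|p [pc pt]] := @exact_interpolation _ (fun sigma => - ((c sigma)^-1 *: w sigma)) r t n.+1.
  move=> sigma k; rewrite (linear_formN _ (lin_e k)) (linear_formZ _ _ (lin_e k)) opprK /r.
  case: eqP => [->|/eqP cn0].
    rewrite invr0 mul0r addr0 /t; case: ifP => _; rewrite ?s1// normr0 ler01//.
  have cp : 0 < c sigma by rewrite lt_neqAle eq_sym cn0 c0.
  rewrite -(ler_pM2l cp) mulfV// -[X in X * _](gtr0_norm cp) -normrM mulrDr.
  rewrite mulrA mulfV// mul1r /t; case: eqP => [->|_]; last by rewrite mulr0 add0r.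
  rewrite cE (_ : _ + _ = s) ?s1//.
  by rewrite mulrBl mul1r mulrAC ss mul1r subrK.
have wp sigma : `|w sigma + c sigma *: p| <= 1.
  have := pc sigma; rewrite /r opprK; case: eqP => [-> _|/eqP cn0].
    by rewrite scale0r addr0; exact: (norm_le_basis he).
  have cp : 0 < c sigma by rewrite lt_neqAle eq_sym cn0 c0.
  rewrite -(ler_pM2l cp) mulfV// -[X in X * _](gtr0_norm cp) -normrZ scalerDr.
  by rewrite scalerA mulfV// scale1r addrC.
exists p; split.
- by move=> k kn; rewrite (pt _ (ltnW kn)) /t ltn_eqF.
- by rewrite pt// /t eqxx.
move=> k; pose z j := e k (v j - (s * e n (v j)) *: p).
(* Signs relative to that of [e k p]: a single sign in front then turns every term into its absolute
   value. *)
pose sigma : {ffun 'I_m -> bool} := [ffun j : 'I_m => (z j < 0)%R (+) (e k p < 0)%R].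
have -> : \sum_(j < m) `|z j| + `|e k p| =
    (-1) ^+ (e k p < 0)%R * e k (w sigma + c sigma *: p).
  rewrite (linear_formD _ _ (lin_e k)) (linear_formZ _ _ (lin_e k)) ew /c.
  rewrite mulrBl mul1r mulr_suml addrCA addrC.
  rewrite -sumrB mulrDr; congr (_ + _); last by rewrite normrEsign.
  rewrite mulr_sumr; apply: eq_bigr => j _.
  rewrite /sg ffunE signr_addb normrEsign /z.
  rewrite (linear_formB _ _ (lin_e k)) (linear_formZ _ _ (lin_e k)).
  by case: (e k p < 0)%R; rewrite ?expr0 ?expr1; ring.
apply: (le_trans (ler_norm _)); rewrite normrM normr_sign mul1r.
exact: le_trans (basis_le he _ _) (wp sigma).
Qed.

End Exact.

(** * Extreme points of the dual ball *)

Section Ext.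
Context {R : realType} {X : completeNormedModType R} (e : nat -> X -> R).
Hypothesis he : ell1_basis e.

Lemma unit_signP (s : R) : `|s| = 1 -> s = 1 \/ s = -1.
Proof.
by have [s0|s0] := leP 0 s; rewrite ?(ger0_norm s0) ?(ltr0_norm s0);
  [left|right; rewrite -[s]opprK; congr (- _)].
Qed.

(** The other coefficients have total mass at most [C - |a n|]; in particular [|a n| = C] forces
    [f = a n * e n]. *)
Lemma rep_coef_dist (f : X -> R) (a : nat -> R^o) (C : R) n x :
  (forall N, \sum_(0 <= i < N) `|a i| <= C) ->
  series (fun i => a i * e i x : R) @ \oo --> (f x : R) ->
  `|f x - a n * e n x| <= (C - `|a n|) * `|x|.
Proof.
move=> aC ax.
have cv : (fun N => `|series (fun i => a i * e i x : R) N - a n * e n x|) @ \oo -->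
    `|f x - a n * e n x|.
  by apply: cvg_norm; apply: cvgB => //; exact: cvg_cst.
apply: (ler_cvgn (N := n.+1) cv) => N nN.
have nin : n \in index_iota 0 N by rewrite mem_index_iota.
rewrite /series/= (bigD1_seq n) ?iota_uniq//= addrAC subrr add0r.
rewrite (le_trans (ler_norm_sum _ _ _))//.
apply: (@le_trans _ _ ((\sum_(0 <= i < N | i != n) `|a i|) * `|x|)).
  rewrite mulr_suml; apply: ler_sum => i _; rewrite normrM ler_wpM2l//.
  exact: basis_le.
rewrite ler_wpM2r// lerBrDl; have := aC N.
by rewrite (bigD1_seq n) ?iota_uniq.
Qed.

Definition signed_basis n (s : R) : X -> R^o := fun x => s * e n x.

Lemma signed_basis_linear n s : linear_form (signed_basis n s).
Proof. by move=> a x y; rewrite /signed_basis (basis_linear he); ring. Qed.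

Lemma signed_basis_le n s x : `|s| = 1 -> `|signed_basis n s x| <= `|x|.
Proof. by move=> s1; rewrite normrM s1 mul1r; exact: basis_le. Qed.

Lemma dual_ball_le (f : X -> R^o) x : dual_ball f -> `|f x| <= `|x|.
Proof.
by move=> [df f1]; rewrite (le_trans (dual_norm_le x df))// ler_piMl.
Qed.

Lemma le_dual_ball (f : X -> R^o) : linear_form f ->
  (forall x, `|f x| <= `|x|) -> dual_ball f.
Proof. by move=> lf f1; apply: bounded_dual => // x; rewrite mul1r. Qed.

Lemma dual_ball_rep (f : X -> R^o) : dual_ball f ->
  exists a : nat -> R^o, (forall N, \sum_(0 <= i < N) `|a i| <= 1) /\
    forall x, series (fun i => a i * e i x : R) @ \oo --> (f x : R).
Proof.
move=> Bf; apply: (basis_rep he) => [||x] //.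
  by case: Bf => df _; exact: dual_linear_form.
by rewrite mul1r dual_ball_le.
Qed.

Lemma signed_basis_ball n s : `|s| = 1 -> dual_ball (signed_basis n s).
Proof.
move=> s1; apply: le_dual_ball => [|x]; first exact: signed_basis_linear.
exact: signed_basis_le.
Qed.

Lemma ext_dual_ballE (f : X -> R^o) :
  ext (@dual_ball R X) f <-> exists n s, `|s| = 1 /\ f = signed_basis n s.
Proof.
split.
  move=> [Bf fext]; have [a [a1 ax]] := dual_ball_rep Bf.
  have lf : linear_form f by case: Bf => df _; exact: dual_linear_form.
  have [n an0] : exists n, a n != 0.
    apply: contrapT => /forallNP a0.
    have f0 x : f x = 0.
      apply: (cvg_unique (@Rhausdorff R) (ax x)).
      rewrite [X in X @ _](_ : _ = cst 0); first exact: cvg_cst.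
      apply/funext => N; rewrite /series/= big1// => i _.
      by have /negP := a0 i; rewrite negbK => /eqP ->; rewrite mul0r.
    (* The zero functional is the midpoint of [e 0] and its opposite, which are not zero. *)
    have := fext (signed_basis 0 1) (signed_basis 0 (-1)) 2^-1.
    case.
    - by apply: signed_basis_ball; rewrite normr1.
    - by apply: signed_basis_ball; rewrite normrN normr1.
    - by apply/andP; split; lra.
    - apply/funext => x; rewrite f0 !fctE /signed_basis /GRing.scale/=; lra.
    move=> e0f _; have : 1 * delta 0 0 = 0 :> R.
      apply: (basis_inj he) => x; rewrite mul0r -(f0 x) -e0f//.
    by rewrite /delta eqxx mulr1 => /eqP; rewrite oner_eq0.
  have hd x := @rep_coef_dist f a 1 n x a1 (ax x).
  have alp : 0 < `|a n| by rewrite normr_gt0.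
  have s1 : `|Num.sg (a n)| = 1 by rewrite normr_sg an0.
  exists n, (Num.sg (a n)); split=> //.
  have := coef_le n a1; rewrite le_eqVlt => /predU1P[an1|an1].
    apply/funext => x; have := hd x; rewrite an1 subrr mul0r normr_le0 subr_eq0.
    by move=> /eqP ->; rewrite /signed_basis {1}[a n]numEsg an1 mulr1.
  have be : 0 < 1 - `|a n| by rewrite subr_gt0.
  (* The normalised remainder: [f] is the convex combination of the signed [e n] and [z] with weight
     [|a n|], so extremality identifies it with the former. *)
  pose z : X -> R^o := fun x => (1 - `|a n|)^-1 * (f x - a n * e n x).
  have Bz : dual_ball z.
    apply: le_dual_ball => [b x y|x].
      by rewrite /z lf (basis_linear he); ring.
    by rewrite /z normrM gtr0_norm ?invr_gt0// ler_pdivrMl.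
  have [||<- _ //] := fext _ _ `|a n| (signed_basis_ball n s1) Bz.
    by rewrite alp.
  apply/funext => x; rewrite !fctE /signed_basis /z /GRing.scale/= mulrA.
  by rewrite [`|a n| * _]mulrC -numEsg mulrA mulfV ?gt_eqF// mul1r subrKC.
move=> [n [s [s1 ->]]]; split; first exact: signed_basis_ball.
have key (b c t : R) : `|b| <= 1 -> `|c| <= 1 -> 0 < t < 1 -> t * b + (1 - t) * c = s -> b = s.
  move=> b1 c1 /andP[t0 t1] h.
  have := unit_signP s1.
  move: b1 c1; rewrite !ler_norml => /andP[b1 b2] /andP[c1 c2] [] sE; rewrite sE in h *.
    by apply/eqP; rewrite eq_le b2/=; nra.
  by apply/eqP; rewrite eq_le b1 andbT; nra.
have key2 y z t : dual_ball y -> dual_ball z -> 0 < t < 1 ->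
    signed_basis n s = t *: y + (1 - t) *: z -> y = signed_basis n s.
  move=> By Bz t01 E; have [b [b1 bx]] := dual_ball_rep By.
  have [c [c1 cx]] := dual_ball_rep Bz.
  have [t0 t1] : 0 <= t /\ 0 <= 1 - t by move/andP: t01 => [? ?]; split; lra.
  (* The coefficients of [t y + (1 - t) z - s e_n], all zero. At [n], extremality of [s] in [-1, 1]
     gives [b n = s], which exhausts the mass of [y]. *)
  pose d : nat -> R^o := fun i => t * b i + (1 - t) * c i - s * delta n i.
  have d0 : d = 0.
    apply: (basis_uniq he).
      apply: (proj1 (@ell1_bounded R d (t * 1 + (1 - t) * 1 + 1) _)) => N.
      apply: (@le_trans _ _ (\sum_(0 <= i < N) (t * `|b i| + (1 - t) * `|c i| + `|delta n i|))).
        apply: ler_sum => i _; rewrite (le_trans (ler_normB _ _))//.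
        rewrite lerD// ?normrM ?s1 ?mul1r//.
        by rewrite (le_trans (ler_normD _ _))// !normrM (ger0_norm t0) (ger0_norm t1).
      rewrite !big_split/= -!mulr_sumr; apply: lerD; last exact: sum_delta_le1.
      by apply: lerD; apply: ler_wpM2l.
    move=> x; have y0 : t * y x + (1 - t) * z x - s * e n x = 0.
      by rewrite -[s * _]/(signed_basis n s x) E subrr.
    rewrite -[X in _ --> X]y0 [X in X @ _](_ : _ = (fun N =>
      t * series (fun i => b i * e i x : R) N
      + (1 - t) * series (fun i => c i * e i x : R) N
      - s * series (fun i => delta n i * e i x : R) N)).
      apply: cvgB; first by apply: cvgD; apply: cvgMr; [exact: bx|exact: cx].
      by apply: cvgMr; exact: delta_series.
    apply/funext => N; rewrite /series/= !mulr_sumr -big_split/= -sumrB.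
    by apply: eq_bigr => i _; rewrite /d; ring.
  have bn : b n = s.
    apply: (key _ (c n) t) => //; [exact: (coef_le n b1)|exact: (coef_le n c1)|].
    have : d n = 0 by rewrite d0.
    by rewrite /d /delta eqxx mulr1 => /eqP; rewrite subr_eq0 => /eqP.
  apply/funext => x; have := @rep_coef_dist y b 1 n x b1 (bx x).
  by rewrite bn s1 subrr mul0r normr_le0 subr_eq0 => /eqP.
move=> y z t By Bz t01 E; split; first exact: key2 By Bz t01 E.
apply: (key2 z y (1 - t)) => //.
  by move/andP: t01 => [? ?]; apply/andP; split; lra.
by rewrite E addrC subKr.
Qed.

End Ext.

(** * From a weak* cluster point to a copy of W alpha *)

Section Tower.
Context {R : realType} {X : completeNormedModType R} (e : nat -> X -> R).
Hypothesis he : ell1_basis e.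

Lemma ptws_nbhs_ball (g : {ptws X -> R}) (x : X) (d : R) : 0 < d ->
  nbhs g [set f : {ptws X -> R} | `|f x - g x| < d].
Proof.
move=> d0; have cx : (fun f : {ptws X -> R} => f x) @ nbhs g --> g x.
  exact: (@proj_continuous X (fun=> R) x g).
have /cvgrPdist_lt/(_ d d0) h := cx.
by apply: filterS h => f /=; rewrite distrC.
Qed.

(** A point where [h] and [g] differ separates them. The implication also covers [h = g], so that
    such neighbourhoods can be intersected without case distinction. *)
Lemma ptws_nbhs_avoid (g h : {ptws X -> R}) :
  nbhs g [set f : {ptws X -> R} | f = h -> h = g].
Proof.
have [->|hg] := pselect (h = g); first by apply: filterE => f.
have [x hgx] : exists x, h x <> g x.
  by apply: contrapT => /forallNP H; apply: hg; apply/funext => x; exact: contrapT.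
have d0 : 0 < `|h x - g x| by rewrite normr_gt0 subr_eq0; exact/eqP.
apply: filterS (ptws_nbhs_ball g x d0) => f /= + fh.
by rewrite fh ltxx.
Qed.

Section Cluster.
Variable g : X -> R^o.
Hypothesis hg : weakstar_cluster (ext (@dual_ball R X)) g.

(** Indices below [M] can be excluded: functionals different from [g] by shrinking the
    neighbourhood, one equal to [g] because the notion of cluster point is punctured. *)
Lemma cluster_select (v : nat -> X) (m M : nat) (d : R) : 0 < d ->
  exists n s, [/\ (M <= n)%N, `|s| = 1 &
    forall j, (j < m)%N -> `|s * e n (v j) - g (v j)| <= d].
Proof.
move=> d0; pose U1 m (f : {ptws X -> R}) := forall j, (j < m)%N -> `|f (v j) - g (v j)| < d.
pose U2 M (f : {ptws X -> R}) := forall i s, (i < M)%N -> `|s| = 1 ->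
  f = signed_basis e i s -> f = g.
have nU1 : nbhs (g : {ptws X -> R}) (U1 m).
  elim: m => [|m' IH]; first by apply: filterE => f.
  apply: filterS (filterI IH (ptws_nbhs_ball g (v m') d0)) => f [f1 f2] j.
  by rewrite ltnS leq_eqVlt => /predU1P[->//|]; exact: f1.
have nU2 : nbhs (g : {ptws X -> R}) (U2 M).
  elim: M => [|M' IH]; first by apply: filterE => f.
  have n1 := ptws_nbhs_avoid g (signed_basis e M' 1).
  have n2 := ptws_nbhs_avoid g (signed_basis e M' (-1)).
  apply: filterS (filterI IH (filterI n1 n2)) => f [f1 [f2 f3]] j s.
  rewrite ltnS leq_eqVlt => /predU1P[->|jM]; last exact: f1.
  by move=> /unit_signP[->|->] fE; [rewrite fE f2|rewrite fE f3].
case: hg => _ /(_ _ (filterI nU1 nU2))[f [fg fext [fU1 fU2]]].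
have [n [s [s1 fE]]] := (ext_dual_ballE he f).1 fext.
exists n, s; split=> //.
  rewrite leqNgt; apply/negP => nM; move/eqP: fg; apply.
  exact: fU2 nM s1 fE.
by move=> j jm; have := fU1 j jm; rewrite fE => /ltW.
Qed.

Lemma cluster_linear : linear_form g.
Proof. by case: hg => dg _; exact: dual_linear_form. Qed.

Lemma cluster_le x : `|g x| <= `|x|.
Proof.
apply/ler_addgt0Pr => d d0.
have [n [s [_ s1 /(_ 0%N isT)]]] := @cluster_select (fun=> x) 1 0 d d0.
have := signed_basis_le he n x s1; rewrite /signed_basis => h1.
have := ler_distD (s * e n x) (g x) 0; rewrite !subr0 [`|g x - _|]distrC.
by move=> *; lra.
Qed.

Lemma cluster_rep : exists a : nat -> R^o,
  (forall N, \sum_(0 <= i < N) `|a i| <= 1) /\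
  forall x, series (fun i => a i * e i x : R) @ \oo --> (g x : R).
Proof.
apply: (basis_rep he cluster_linear ler01) => x.
by rewrite mul1r cluster_le.
Qed.

Lemma cluster_small (d : R) : 0 < d ->
  exists M, forall n p, (M <= n)%N -> (forall k, (k < n)%N -> e k p = 0) ->
    `|p| <= 1 -> `|g p| <= d.
Proof.
move=> d0; have [a [a1 ax]] := cluster_rep.
have [M hM] := summable_tail a1 d0.
exists M => n p Mn ep p1.
apply: (ler_cvgn (N := M) (cvg_norm (ax p))) => N MN.
rewrite /series/= (@big_cat_nat _ _ +%R M)//= big1_seq ?add0r; last first.
  move=> i /andP[_]; rewrite mem_index_iota => /andP[_ iM].
  by rewrite ep ?mulr0// (leq_trans iM).
apply: le_trans (hM N MN); rewrite (le_trans (ler_norm_sum _ _ _))//.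
apply: ler_sum => i _; rewrite normrM ler_piMr//.
exact: le_trans (basis_le he _ _) p1.
Qed.

End Cluster.

(** The first clause bounds the map sending [x] in l_oo^m to [\sum_j x j *: v j] from above,
    biorthogonality bounds it from below, so it is isometric. The basis indices used so far lie
    below [b]. *)
Definition good_stage (m : nat) (F : nat -> X -> R) (v : nat -> X) (b : nat) :=
  [/\ forall k, \sum_(0 <= j < m) `|e k (v j)| <= 1,
      forall i, (i < m)%N -> exists n s, [/\ (n < b)%N, `|s| = 1 & F i = signed_basis e n s]
    & forall i j, (i < m)%N -> (j < m)%N -> F i (v j) = (i == j)%:R].

(** Subtracting from [v j] its new coordinate times the new vector restores biorthogonality, and the
    old span stays inside the new one. The old functionals vanish on the new vector because
    [b <= n]. *)
Lemma extend_stage m F v b n s : good_stage m F v b -> (b <= n)%N -> `|s| = 1 ->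
  exists F' v', [/\ good_stage m.+1 F' v' n.+1, forall i, (i < m)%N -> F' i = F i,
     F' m = signed_basis e n s,
     forall j, (j < m)%N -> v j = v' j + (s * e n (v j)) *: v' m &
     (forall k, (k < n)%N -> e k (v' m) = 0) /\ `|v' m| <= 1].
Proof.
move=> [v1 Fb Fv] bn s1.
have v1' k : \sum_(j < m) `|e k (v j)| <= 1 by have := v1 k; rewrite big_mkord.
have [p [ep0 eps hp]] := @extension_step _ _ e he m n v s s1 v1'.
have lin_e k := basis_linear he k.
pose F' i := if (i < m)%N then F i else signed_basis e n s.
pose v' j := if (j < m)%N then v j - (s * e n (v j)) *: p else p.
have v'm : v' m = p by rewrite /v' ltnn.
have F'm : F' m = signed_basis e n s by rewrite /F' ltnn.
have v'lt j : (j < m)%N -> v' j = v j - (s * e n (v j)) *: p by rewrite /v' => ->.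
have F'lt i : (i < m)%N -> F' i = F i by rewrite /F' => ->.
have ss : s * s = 1 by rewrite -expr2 -real_normK ?num_real// s1 expr1n.
have hp' k : \sum_(0 <= j < m) `|e k (v' j)| + `|e k p| <= 1.
  rewrite big_mkord; apply: le_trans (hp k); rewrite lerD2r.
  by apply: ler_sum => j _; rewrite v'lt.
exists F', v'; split=> //.
- split.
  + by move=> k; rewrite big_nat_recr//= v'm.
  + move=> i; rewrite ltnS leq_eqVlt => /predU1P[->|im].
      by exists n, s; rewrite F'm.
    have [n' [s' [n'b s'1 FE]]] := Fb i im.
    by exists n', s'; rewrite F'lt//; split=> //; rewrite ltnS (leq_trans (ltnW n'b)).
  + have Fp i : (i < m)%N -> F i p = 0.
      move=> im; have [n' [s' [n'b s'1 ->]]] := Fb i im.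
      by rewrite /signed_basis ep0 ?mulr0// (leq_trans n'b).
    have Flin i : (i < m)%N -> linear_form (F i).
      by move=> im; have [n' [s' [_ _ ->]]] := Fb i im; exact: signed_basis_linear.
    move=> i j; rewrite ltnS leq_eqVlt => /predU1P[->|im];
      rewrite ltnS leq_eqVlt => /predU1P[->|jm].
    * by rewrite F'm v'm eqxx /signed_basis eps.
    * rewrite F'm v'lt// (gtn_eqF jm) /signed_basis.
      rewrite (linear_formB _ _ (lin_e n)) (linear_formZ _ _ (lin_e n)) eps.
      by rewrite mulrBr -mulrA [e n (v j) * s]mulrC (mulrA s s) ss mul1r subrr.
    * by rewrite F'lt// v'm Fp// (ltn_eqF im).
    * rewrite F'lt// v'lt// (linear_formB _ _ (Flin i im)) (linear_formZ _ _ (Flin i im)).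
      by rewrite Fp// mulr0 subr0 Fv.
- by move=> j jm; rewrite v'lt// v'm subrK.
rewrite v'm; split=> //; apply: (norm_le_basis he) => k.
by apply: le_trans (hp' k); rewrite lerDr sumr_ge0.
Qed.

Lemma initial_stage N : exists v,
  good_stage N (fun i => signed_basis e i 1) v N.
Proof.
elim: N => [|N [v gv]].
  by exists (fun=> 0); split=> // k; rewrite big_geq.
have [F' [v' [[h1 _ h3] FF' F'N _ _]]] := @extend_stage N _ v N N 1 gv (leqnn _) (normr1 _).
have F'E i : (i < N.+1)%N -> F' i = signed_basis e i 1.
  by rewrite ltnS leq_eqVlt => /predU1P[->//|]; exact: FF'.
exists v'; split=> // [i iN|i j iN jN]; last by rewrite -F'E// h3.
by exists i, 1; rewrite normr1.
Qed.

(** Functionals are frozen once chosen and form a single sequence; the vectors change with the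
    stage, hence the double index of [v]. *)
Lemma tower (g : X -> R^o) (N : nat) (eta : nat -> R) :
  weakstar_cluster (ext (@dual_ball R X)) g -> (forall l, 0 < eta l) ->
  exists (F : nat -> X -> R) (v : nat -> nat -> X),
  [/\ (forall l k, \sum_(0 <= j < (N + l)%N) `|e k (v l j)| <= 1) /\
      (forall i, exists n s, `|s| = 1 /\ F i = signed_basis e n s),
      (forall l i j, (i < N + l)%N -> (j < N + l)%N -> F i (v l j) = (i == j)%:R) /\
      (forall l j, (j < N + l)%N -> v l j = v l.+1 j + F (N + l)%N (v l j) *: v l.+1 (N + l)%N),
      forall l, \sum_(0 <= j < (N + l)%N) `|F (N + l)%N (v l j) - g (v l j)| <= eta l,
      forall l, `|g (v l.+1 (N + l)%N)| <= eta l &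
      forall i, (i < N)%N -> F i = signed_basis e i 1].
Proof.
move=> hg eta0; pose S := ((nat -> X -> R) * (nat -> X) * nat)%type.
pose good m (st : S) := good_stage m st.1.1 st.1.2 st.2.
pose rel l (st st' : S) := let m := (N + l)%N in
  [/\ good m.+1 st', forall i, (i < m)%N -> st'.1.1 i = st.1.1 i,
     forall j, (j < m)%N -> st.1.2 j = st'.1.2 j + st'.1.1 m (st.1.2 j) *: st'.1.2 m,
     \sum_(0 <= j < m) `|st'.1.1 m (st.1.2 j) - g (st.1.2 j)| <= eta l &
     `|g (st'.1.2 m)| <= eta l].
have step l (st : S) : good (N + l)%N st -> exists st', rel l st st'.
  case: st => -[F v] b gst; set m := (N + l)%N in gst *.
  have [M hM] := cluster_small hg (eta0 l).
  (* [m] errors of this size add up to at most [eta l]; the denominator [m.+1] allows [m = 0]. *)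
  have d0 : 0 < eta l / m.+1%:R by rewrite divr_gt0.
  have [n [s [Mn s1 ns]]] := cluster_select hg v m (maxn b M) d0.
  have [F' [v' [g' FF' F'm v'E [v'0 v'1]]]] := extend_stage gst (leq_trans (leq_maxl _ _) Mn) s1.
  exists (F', v', n.+1); split=> //=.
  - by move=> j jm; rewrite F'm; exact: v'E.
  - rewrite F'm big_mkord; apply: (@le_trans _ _ (\sum_(j < m) eta l / m.+1%:R)).
      by apply: ler_sum => j _; exact: ns.
    rewrite sumr_const card_ord -[leLHS]mulr_natr mulrAC ler_pdivrMr// ler_wpM2l ?ltW//.
    by rewrite ltr_nat.
  - by apply: (hM n) => //; exact: leq_trans (leq_maxr _ _) Mn.
have /choice[next hnext] (ls : nat * S) : exists st', good (N + ls.1)%N ls.2 -> rel ls.1 ls.2 st'.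
  case: ls => l st /=; have [/step[st' ?]|ng] := pselect (good (N + l)%N st); first by exists st'.
  by exists st.
have [v0 gv0] := initial_stage N.
pose st := fix st l : S :=
  if l is l'.+1 then next (l', st l') else (fun i => signed_basis e i 1 : X -> R, v0, N).
have gst l : good (N + l)%N (st l).
  elim: l => [|l IH]; first by rewrite addn0.
  by rewrite addnS; have [] := hnext (l, st l) IH.
have rst l : rel l (st l) (st l.+1) := hnext (l, st l) (gst l).
(* Stage [i.+1] already contains the index [i], whatever [N] is. *)
pose F i := (st i.+1).1.1 i.
have agree l k i : (i < N + l)%N -> (st (l + k)%N).1.1 i = (st l).1.1 i.
  move=> il; elim: k => [|k IH]; first by rewrite addn0.
  have [_ + _ _ _] := rst (l + k)%N; rewrite addnS -IH; apply.
  by rewrite (leq_trans il)// addnA leq_addr.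
have FE l i : (i < N + l)%N -> (st l).1.1 i = F i.
  move=> il; have ii : (i < N + i.+1)%N by rewrite addnS ltnS leq_addl.
  by rewrite /F -(agree l i.+1 i il) -(agree i.+1 l i ii) addnC.
exists F, (fun l => (st l).1.2); split.
- split=> [l k|i]; first by have [] := gst l.
  have [_ /(_ i) h _] := gst i.+1; have [|n [s [_ s1 FF]]] := h; last by exists n, s.
  by rewrite addnS ltnS leq_addl.
- split=> [l i j il jl|l j jl]; first by rewrite -(FE l)//; have [_ _ ->] := gst l.
  have [_ _ h _ _] := rst l; rewrite {1}h//.
  by rewrite (FE l.+1) ?addnS.
- move=> l; have [_ _ _ + _] := rst l.
  by rewrite (FE l.+1) ?addnS.
- by move=> l; have [_ _ _ _] := rst l.
- by move=> i iN; rewrite -(FE 0%N) ?addn0.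
Qed.

End Tower.

Section SupNorm.
Context {R : realType}.
Implicit Types (x : nat -> R^o) (C : R).

Lemma sup_norm_ub x C i : (forall j, `|x j| <= C) -> `|x i| <= sup_norm x.
Proof.
by move=> xC; apply: ub_le_sup; [exists C => _ [j _ <-]; exact: xC|exists i].
Qed.

Lemma sup_norm_le x C : (forall j, `|x j| <= C) -> sup_norm x <= C.
Proof.
move=> xC; apply: ge_sup; first by exists `|x 0%N|, 0%N.
by move=> _ [j _ <-]; exact: xC.
Qed.

Lemma cvgn_bounded x : cvgn (x : nat -> R) -> exists C, forall j, `|x j| <= C.
Proof.
move=> /cvg_has_ub[C hC]; exists C => j; apply: hC.
by exists j.
Qed.

Lemma W_bounded (alpha : nat -> R^o) x : W alpha x -> exists C, forall j, `|x j| <= C.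
Proof. by move=> [cx _]; exact: cvgn_bounded. Qed.

End SupNorm.

(** * The limit of a tower is a copy of W alpha *)

Section LimitSpace.
Context {R : realType} {X : completeNormedModType R} (e : nat -> X -> R).
Hypothesis he : ell1_basis e.
Variables (g : X -> R^o) (N : nat) (c0 : R) (F : nat -> X -> R) (v : nat -> nat -> X).
Hypotheses (c0_gt0 : 0 < c0) (lg : linear_form g) (g_le : forall x, `|g x| <= `|x|).
Let eta l : R := c0 * 2^-1 ^+ l.
Hypothesis v_le : forall l k, \sum_(0 <= j < (N + l)%N) `|e k (v l j)| <= 1.
Hypothesis F_basis : forall i, exists n s, `|s| = 1 /\ F i = signed_basis e n s.
Hypothesis Fv : forall l i j, (i < N + l)%N -> (j < N + l)%N -> F i (v l j) = (i == j)%:R.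
Hypothesis v_succ : forall l j, (j < N + l)%N ->
  v l j = v l.+1 j + F (N + l)%N (v l j) *: v l.+1 (N + l)%N.
Hypothesis F_close : forall l,
  \sum_(0 <= j < (N + l)%N) `|F (N + l)%N (v l j) - g (v l j)| <= eta l.
Hypothesis g_new : forall l, `|g (v l.+1 (N + l)%N)| <= eta l.

Let lin_e k : linear_form (e k). Proof. exact: basis_linear. Qed.
Let lF i : linear_form (F i).
Proof. by have [n [s [_ ->]]] := F_basis i; exact: signed_basis_linear. Qed.
Let F_le i x : `|F i x| <= `|x|.
Proof. by have [n [s [s1 ->]]] := F_basis i; exact: signed_basis_le. Qed.
Let eta_gt0 l : 0 < eta l. Proof. by rewrite mulr_gt0// exprn_gt0. Qed.
Let eta_small (d : R) : 0 < d -> exists L, forall l, (L <= l)%N -> eta l <= d.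
Proof.
move=> d0; have [|L hL] := @half_expn_small R (d / c0); first exact: divr_gt0.
by exists L => l /hL; rewrite ler_pdivlMr// mulrC.
Qed.
Let etaS l : eta l.+1 = eta l / 2.
Proof. by rewrite /eta exprS; field. Qed.
Let eta_le l k : eta (l + k)%N <= eta l.
Proof.
elim: k => [|k IH]; first by rewrite addn0.
by rewrite addnS etaS; have := eta_gt0 (l + k); lra.
Qed.

Definition stage_comb l (x : nat -> R) : X := \sum_(0 <= j < (N + l)%N) x j *: v l j.

Let P := stage_comb.
Let Fc (y : X) : nat -> R := fun k => F k y.

Lemma stage_combE (f : X -> R) l x : linear_form f ->
  f (P l x) = \sum_(0 <= j < (N + l)%N) x j * f (v l j).
Proof.
move=> lf; rewrite linear_form_sum//; apply: eq_bigr => j _.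
by rewrite linear_formZ.
Qed.

Lemma eq_stage_comb l x y : (forall j, (j < N + l)%N -> x j = y j) -> P l x = P l y.
Proof. by move=> xy; apply: eq_big_nat => j /andP[_ jl]; rewrite xy. Qed.

Lemma stage_combB l x y : P l (fun j => x j - y j) = P l x - P l y.
Proof. by rewrite /P /stage_comb -sumrB; apply: eq_bigr => j _; rewrite scalerBl. Qed.

Lemma stage_comb_le l x C : 0 <= C -> (forall j, (j < N + l)%N -> `|x j| <= C) ->
  `|P l x| <= C.
Proof.
move=> C0 xC; apply: (norm_le_basis he) => k; rewrite stage_combE//.
rewrite (le_trans (ler_norm_sum _ _ _))//.
apply: (@le_trans _ _ (C * \sum_(0 <= j < (N + l)%N) `|e k (v l j)|)); last by rewrite ler_piMr.
rewrite mulr_sumr [leLHS]big_nat [leRHS]big_nat; apply: ler_sum => j /andP[_ jl].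
by rewrite normrM ler_wpM2r// xC.
Qed.

Lemma stage_coord l x k : (k < N + l)%N -> F k (P l x) = x k.
Proof.
move=> kl; rewrite stage_combE//.
rewrite (bigD1_seq k) ?mem_index_iota ?iota_uniq//= Fv// eqxx mulr1.
rewrite big1_seq ?addr0// => j /andP[jk]; rewrite mem_index_iota => /andP[_ jl].
by rewrite Fv// eq_sym (negPf jk) mulr0.
Qed.

(** The coefficient that the new vector collects through [v_succ] is the value of the new functional
    on [P l x]. *)
Lemma stage_comb_succ l x : P l x = P l.+1 (Fc (P l x)).
Proof.
rewrite [RHS]/P /stage_comb addnS big_nat_recr//= [in RHS]/Fc [X in _ + X *: _]stage_combE//.
rewrite scaler_suml -big_split/= [LHS]big_nat [RHS]big_nat.
apply: eq_bigr => j /andP[_ jl]; rewrite stage_coord//.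
by rewrite {1}v_succ// scalerDr scalerA.
Qed.

Lemma stage_comb_later l k x : P l x = P (l + k)%N (Fc (P l x)).
Proof.
elim: k => [|k IH].
  by rewrite addn0; apply: eq_stage_comb => j jl; rewrite /Fc stage_coord.
by rewrite addnS {1}IH stage_comb_succ -IH.
Qed.

(** [P l x] is rewritten in the stage to which [F k] is about to be added; its coordinates there are
    still bounded by [C], and [F_close] applies. *)
Lemma stage_close l x C k : 0 <= C -> (forall j, (j < N + l)%N -> `|x j| <= C) ->
  (N + l <= k)%N -> `|F k (P l x) - g (P l x)| <= C * eta l.
Proof.
move=> C0 xC lk; rewrite -(subnKC lk) -addnA; set d := (k - _)%N.
have PC := stage_comb_le C0 xC.
rewrite (stage_comb_later l d x) (stage_combE _ _ (lF _)) (stage_combE _ _ lg) -sumrB.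
rewrite (le_trans (ler_norm_sum _ _ _))//.
apply: (@le_trans _ _ (C * \sum_(0 <= j < (N + (l + d))%N)
   `|F (N + (l + d))%N (v (l + d)%N j) - g (v (l + d)%N j)|)).
  rewrite mulr_sumr; apply: ler_sum => j _; rewrite -mulrBr normrM ler_wpM2r//.
  exact: le_trans (F_le _ _) PC.
by rewrite ler_wpM2l// (le_trans (F_close _))// eta_le.
Qed.

Let beta l j : R := g (v l j).

(** [v l j] changes by [F (N + l) (v l j)] times the new vector, where [g] is at most [eta l]. These
    factors have sum at most 1 in absolute value since [F (N + l)] is a signed basis functional. *)
Lemma beta_succ l : \sum_(0 <= j < (N + l)%N) `|beta l.+1 j - beta l j| <= eta l.
Proof.
have [n [s [s1 FE]]] := F_basis (N + l)%N.
apply: (@le_trans _ _ (eta l * \sum_(0 <= j < (N + l)%N) `|e n (v l j)|)); last first.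
  by rewrite ler_piMr// ltW.
rewrite mulr_sumr [leLHS]big_nat [leRHS]big_nat; apply: ler_sum => j /andP[_ jl].
rewrite /beta {1}(v_succ jl) (linear_formD _ _ lg) (linear_formZ _ _ lg).
rewrite opprD addrA subrr add0r normrN normrM mulrC ler_pM//.
by rewrite FE normrM s1 mul1r.
Qed.

Lemma beta_later l k :
  \sum_(0 <= j < (N + l)%N) `|beta (l + k)%N j - beta l j| <= 2 * (eta l - eta (l + k)%N).
Proof.
elim: k => [|k IH].
  by rewrite addn0 subrr mulr0 big1// => j _; rewrite subrr normr0.
apply: (@le_trans _ _ (\sum_(0 <= j < (N + l)%N) (`|beta (l + k).+1 j - beta (l + k)%N j| +
   `|beta (l + k)%N j - beta l j|))).
  by rewrite addnS; apply: ler_sum => j _; exact: ler_distD.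
rewrite big_split/= addnS etaS.
have : \sum_(0 <= j < (N + l)%N) `|beta (l + k).+1 j - beta (l + k)%N j| <= eta (l + k)%N.
  apply: le_trans (beta_succ _).
  by rewrite [leRHS](@big_cat_nat _ _ +%R (N + l)) ?leq_add2l ?leq_addr//= lerDl sumr_ge0.
by move: IH => *; lra.
Qed.

Lemma beta_later_le l l' : (l <= l')%N ->
  \sum_(0 <= j < (N + l)%N) `|beta l' j - beta l j| <= 2 * eta l.
Proof.
move=> ll'; rewrite -(subnKC ll'); apply: le_trans (beta_later _ _) _.
by have := eta_gt0 (l + (l' - l)); lra.
Qed.

Lemma beta_cvg j : cvgn (fun l => beta l j).
Proof.
apply: (@cvgn_cauchy R R^o) => d d0.
have [|L hL] := @eta_small (d / 2); first by rewrite divr_gt0.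
exists (maxn L j.+1) => l Ll.
have := beta_later_le Ll; rewrite (bigD1_seq j) ?mem_index_iota ?iota_uniq//=; last first.
  by rewrite (leq_trans (leq_maxr L j.+1))// leq_addl.
have := hL _ (leq_maxl L j.+1).
have : 0 <= \sum_(0 <= i < (N + maxn L j.+1)%N | i != j)
  `|beta l i - beta (maxn L j.+1) i| by apply: sumr_ge0.
by move=> *; lra.
Qed.

(** The vectors [v l j] themselves need not converge as [l] grows: beyond [N + l] their coordinates
    stay close to [alpha j]. Only the values of [g] settle down. *)
Definition limit_coef (j : nat) : R^o := limn (fun l => g (v l j)).

Let alpha := limit_coef.

Lemma limit_coef_cvg j : (fun l => beta l j) @ \oo --> (alpha j : R).
Proof. exact: beta_cvg. Qed.

Lemma limit_coef_dist l : \sum_(0 <= j < (N + l)%N) `|alpha j - beta l j| <= 2 * eta l.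
Proof.
have cv : (fun k => \sum_(0 <= j < (N + l)%N) `|beta k j - beta l j|) @ \oo -->
    \sum_(0 <= j < (N + l)%N) `|alpha j - beta l j|.
  apply: cvgn_sum => j; apply: cvg_norm; apply: cvgB; last exact: cvg_cst.
  exact: limit_coef_cvg.
exact: (ler_cvgn (N := l) cv) (@beta_later_le l).
Qed.

Lemma beta_sum l : \sum_(0 <= j < (N + l)%N) `|beta l j| <= 1.
Proof.
have -> : \sum_(0 <= j < (N + l)%N) `|beta l j| = g (P l (fun j => (-1) ^+ (beta l j < 0)%R)).
  by rewrite stage_combE//; apply: eq_bigr => j _; rewrite normrEsign.
rewrite (le_trans (ler_norm _))// (le_trans (g_le _))//.
by apply: stage_comb_le => // j _; rewrite normr_sign.
Qed.

Lemma limit_coef_sum n : \sum_(0 <= j < n) `|alpha j| <= 1.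
Proof.
have cv : (fun k => \sum_(0 <= j < n) `|beta k j|) @ \oo --> \sum_(0 <= j < n) `|alpha j|.
  by apply: cvgn_sum => j; apply: cvg_norm; exact: limit_coef_cvg.
apply: (ler_cvgn (N := n) cv) => l nl; apply: le_trans (beta_sum l).
by rewrite [leRHS](@big_cat_nat _ _ +%R n) ?(leq_trans nl) ?leq_addl//= lerDl sumr_ge0.
Qed.

Lemma limit_coef_ball : ell1_ball alpha.
Proof. exact: ell1_bounded limit_coef_sum. Qed.

Lemma stage_value l (x : nat -> R) C : 0 <= C -> (forall j, (j < N + l)%N -> `|x j| <= C) ->
  `|series (fun j => alpha j * x j : R) (N + l)%N - g (P l x)| <= 2 * C * eta l.
Proof.
move=> C0 xC; rewrite (stage_combE _ _ lg) /series/= -sumrB.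
rewrite (le_trans (ler_norm_sum _ _ _))// mulrAC mulrC.
apply: (@le_trans _ _ (C * \sum_(0 <= j < (N + l)%N) `|alpha j - beta l j|)); last first.
  by rewrite ler_wpM2l// limit_coef_dist.
rewrite mulr_sumr [leLHS]big_nat [leRHS]big_nat; apply: ler_sum => j /andP[_ jl].
by rewrite [_ * x j]mulrC -mulrBr normrM ler_wpM2r// xC.
Qed.

(** This is the closure of the union of the stages: [P l (Fc y)] is the image of [y] under a
    projection of norm at most 1 onto stage [l]. *)
Definition limit_space : set X := [set y | (fun l => P l (Fc y)) @ \oo --> y].

Lemma stage_comb_Fc_le l y : `|P l (Fc y)| <= `|y|.
Proof. by apply: stage_comb_le => // j _; exact: F_le. Qed.

Lemma limit_space_subspace : is_subspace limit_space.
Proof.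
split=> [|a x y Yx Yy].
  rewrite /limit_space/= [X in X @ _](_ : _ = cst 0); first exact: cvg_cst.
  apply/funext => l; rewrite /P /stage_comb big1// => j _.
  by rewrite /Fc linear_form0// scale0r.
rewrite /limit_space/= [X in X @ _](_ : _ = (fun l => a *: P l (Fc x) + P l (Fc y))).
  by apply: cvgD => //; apply: cvgZr.
apply/funext => l; rewrite /P /stage_comb scaler_sumr -big_split/=.
by apply: eq_bigr => j _; rewrite /Fc lF scalerDl scalerA.
Qed.

Lemma limit_space_closed : closed limit_space.
Proof.
move=> y cy; apply/cvgn_distP => d d0.
have d3 : 0 < d / 3 by rewrite divr_gt0.
have [y' [Yy' yy']] := cy _ (nbhsx_ballx y _ d3).
move: yy'; rewrite -ball_normE/= => /ltW yy'.
have [L hL] := (cvgn_distP _ _).1 Yy' _ d3.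
exists L => l /hL h.
have -> : P l (Fc y) - y = P l (Fc (y - y')) + (P l (Fc y') - y') + (y' - y).
  rewrite (_ : P l (Fc (y - y')) = P l (Fc y) - P l (Fc y')).
    by rewrite [X in _ = X + _]addrA subrK [RHS]addrA subrK.
  by rewrite -stage_combB; apply: eq_stage_comb => j _; rewrite /Fc linear_formB.
have := stage_comb_Fc_le l (y - y').
have := ler_normD (P l (Fc (y - y')) + (P l (Fc y') - y')) (y' - y).
have := ler_normD (P l (Fc (y - y'))) (P l (Fc y') - y').
by rewrite [`|y' - y|]distrC; move=> *; lra.
Qed.

Let coords (y : X) : nat -> R^o := fun k => F k y.

Lemma limit_space_coord_cvg y : limit_space y -> (coords y : nat -> R) @ \oo --> (g y : R).
Proof.
move=> Yy; apply/cvgn_distP => d d0.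
have d3 : 0 < d / 3 by rewrite divr_gt0.
have y1 : 0 < `|y| + 1 by rewrite ltr_wpDl.
have [L1 hL1] := (cvgn_distP _ _).1 Yy _ d3.
have [L2 hL2] := eta_small (divr_gt0 d3 y1).
pose l := maxn L1 L2; exists (N + l)%N => k lk.
have := hL1 l (leq_maxl _ _); have := hL2 l (leq_maxr _ _).
rewrite ler_pdivlMr// => h2 h1.
have h3 := @stage_close l (Fc y) `|y| k (normr_ge0 _) (fun j _ => F_le j y) lk.
have := F_le k (P l (Fc y) - y); rewrite linear_formB// => h4.
have := g_le (P l (Fc y) - y); rewrite linear_formB// => h5.
have := ler_distD (F k (P l (Fc y))) (F k y) (g y).
have := ler_distD (g (P l (Fc y))) (F k (P l (Fc y))) (g y).
rewrite [`|F k y - F k _|]distrC /coords.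
have := eta_gt0 l; move: h1 h2 h3 h4 h5 => *; lra.
Qed.

Lemma limit_space_series y : limit_space y ->
  series (fun i => alpha i * coords y i : R) @ \oo --> (g y : R).
Proof.
move=> Yy; apply/cvgn_distP => d d0.
have d2 : 0 < d / 2 by rewrite divr_gt0.
have y1 : 0 < 2 * `|y| + 1 by rewrite ltr_wpDl// mulr_ge0.
have [L1 hL1] := (cvgn_distP _ _).1 Yy _ d2.
have [L2 hL2] := eta_small (divr_gt0 d2 y1).
exists (N + maxn L1 L2)%N => n Nn.
have Nn' : (N <= n)%N by apply: leq_trans Nn; exact: leq_addr.
rewrite -(subnKC Nn'); set l := (n - N)%N.
have ll : (maxn L1 L2 <= l)%N by rewrite leq_subRL.
have := hL1 l (leq_trans (leq_maxl _ _) ll); have := hL2 l (leq_trans (leq_maxr _ _) ll).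
rewrite ler_pdivlMr// => h2 h1.
have h3 := @stage_value l (Fc y) `|y| (normr_ge0 _) (fun j _ => F_le j y).
have := g_le (P l (Fc y) - y); rewrite linear_formB// => h5.
have := ler_distD (g (P l (Fc y))) (series (fun i => alpha i * coords y i : R) (N + l)%N) (g y).
have := eta_gt0 l; move: h1 h2 h3 h5 => *; lra.
Qed.

Lemma limit_space_norm y : limit_space y -> sup_norm (coords y) = `|y|.
Proof.
move=> Yy; apply/eqP; rewrite eq_le; apply/andP; split.
  by apply: sup_norm_le => j; exact: F_le.
have ub j : `|coords y j| <= sup_norm (coords y) := sup_norm_ub _ (fun j => F_le j y).
apply: (ler_cvgn (N := 0%N) (cvg_norm Yy)) => l _.
by apply: stage_comb_le => //; apply: le_trans (ub 0%N).
Qed.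

(** The [P l x] are Cauchy thanks to the equation of [W alpha]: for large [k], [F k (P l x)] is near
    [g (P l x)], hence near a partial sum of the [alpha i * x i], whose limit is that of [x]. *)
Lemma limit_space_surj x : W alpha x -> exists2 y, limit_space y & coords y = x.
Proof.
move=> Wx; have [C xC] := W_bounded Wx; case: Wx => cx lx.
have C0 : 0 <= C by apply: le_trans (xC 0%N).
have cs : series (fun i => alpha i * x i : R) @ \oo --> (limn (x : nat -> R) : R).
  by rewrite lx; exact: series_summable_cvg limit_coef_sum xC.
have cP : cvgn (fun l => P l x).
  apply: cvgn_cauchy => d d0.
  have d3 : 0 < d / 3 by rewrite divr_gt0.
  (* [stage_close] and [stage_value] cost [C * eta l] and [2 * C * eta l]. *)
  have C1 : 0 < 3 * C + 1 by rewrite ltr_wpDl// mulr_ge0.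
  have [L1 hL1] := (cvgn_distP _ _).1 cx _ d3.
  have [L2 hL2] := (cvgn_distP _ _).1 cs _ d3.
  have [L3 hL3] := eta_small (divr_gt0 d3 C1).
  pose l := maxn L1 (maxn L2 L3); exists l => l' ll'.
  have L1l : (L1 <= N + l)%N by rewrite (leq_trans _ (leq_addl _ _))// leq_maxl.
  have L2l : (L2 <= N + l)%N.
    by rewrite (leq_trans _ (leq_addl _ _))// (leq_trans (leq_maxl L2 L3))// leq_maxr.
  have L3l : (L3 <= l)%N by rewrite (leq_trans (leq_maxr L2 L3))// leq_maxr.
  (* Both vectors lie in stage [l'], so the difference is governed by its coordinates, which vanish
     below [N + l]. *)
  have -> : P l' x - P l x = P l' (fun j => x j - Fc (P l x) j).
    by rewrite stage_combB [in LHS](stage_comb_later l (l' - l) x) subnKC.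
  apply: stage_comb_le => [|k kl']; first exact: ltW.
  have [kl|lk] := ltnP k (N + l); first by rewrite /Fc stage_coord// subrr normr0 ltW.
  have h1 := hL1 k (leq_trans L1l lk).
  have h2 := hL2 _ L2l.
  have := hL3 l L3l; rewrite ler_pdivlMr// => h3.
  have h4 := @stage_close l x C k C0 (fun j _ => xC j) lk.
  have h5 := @stage_value l x C C0 (fun j _ => xC j).
  have t1 := ler_distD (limn (x : nat -> R)) (x k) (F k (P l x)).
  have t2 := ler_distD (series (fun i => alpha i * x i : R) (N + l)%N)
    (limn (x : nat -> R)) (F k (P l x)).
  have t3 := ler_distD (g (P l x)) (series (fun i => alpha i * x i : R) (N + l)%N) (F k (P l x)).
  rewrite [X in _ <= X + _]distrC in t2; rewrite [`|g _ - F _ _|]distrC in t3.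
  rewrite /Fc; have := eta_gt0 l; lra.
set y := limn (fun l => P l x) in cP.
have Fy k : F k y = x k.
  have cF : (fun l => F k (P l x)) @ \oo --> F k y.
    apply/cvgn_distP => d /((cvgn_distP _ _).1 cP)[L hL]; exists L => l /hL h.
    by rewrite -linear_formB// (le_trans (F_le _ _)).
  apply: (cvg_unique (@Rhausdorff R) cF); apply/cvgn_distP => d d0.
  exists k.+1 => l kl; rewrite stage_coord ?subrr ?normr0 ?ltW//.
  by rewrite (leq_trans kl)// leq_addl.
have Fyx : Fc y = x by apply/funext.
by exists y => //; rewrite /limit_space/= Fyx.
Qed.

Lemma limit_space_iso :
  isometrically_isomorphic limit_space (fun y : X => `|y|) (W alpha) sup_norm.
Proof.
exists coords; split; last exact: limit_space_norm.
- split.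
  + move=> y Yy; have cy := limit_space_coord_cvg Yy; have sy := limit_space_series Yy.
    split; first by apply/cvg_ex; exists (g y).
    by rewrite (cvg_lim (@Rhausdorff R) cy) (cvg_lim (@Rhausdorff R) sy).
  + move=> y y'; rewrite !inE => Yy Yy' E.
    have Yy2 : (fun l => P l (Fc y)) @ \oo --> y'.
      by rewrite (_ : Fc y = Fc y').
    exact: (cvg_unique (@norm_hausdorff R X) Yy Yy2).
  + by move=> x /limit_space_surj[y Yy <-]; exists y.
- by move=> a x y _ _; apply/funext => k; exact: lF.
Qed.

Lemma limit_space_contains : contains_isometric_copy X (W alpha) sup_norm.
Proof.
exists limit_space; split.
- exact: limit_space_subspace.
- exact: limit_space_closed.
- exact: limit_space_iso.
Qed.

Lemma limit_coef_norm_ge : \sum_(0 <= j < N) `|g (v 0%N j)| - 2 * c0 <= ell1_norm alpha.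
Proof.
have [la _] := limit_coef_ball.
apply: le_trans (ell1_partial_le N la); rewrite lerBlDr.
have := limit_coef_dist 0%N; rewrite addn0 /eta expr0 mulr1 => h.
apply: (@le_trans _ _ (\sum_(0 <= j < N) (`|alpha j| + `|alpha j - beta 0%N j|))).
  apply: ler_sum => j _; have := ler_distD (alpha j) (beta 0%N j) 0.
  by rewrite !subr0 [`|beta _ _ - _|]distrC addrC.
by rewrite big_split/= lerD2l.
Qed.

End LimitSpace.

(** * Comparison of the norms of g and alpha *)

Section UpperBound.
Context {R : realType} {X : completeNormedModType R} (e : nat -> X -> R).
Hypothesis he : ell1_basis e.

Lemma cluster_approx (g : X -> R^o) (d : R) :
  weakstar_cluster (ext (@dual_ball R X)) g -> 0 < d ->
  exists alpha : nat -> R^o, [/\ ell1_ball alpha,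
    contains_isometric_copy X (W alpha) sup_norm &
    dual_norm g <= ell1_norm alpha + d].
Proof.
(* One quarter pays for the tail of [a], one for [close], and two for the loss [2 * c0] with
   [c0 = d / 4]. *)
move=> hg d0; have d4 : 0 < d / 4 by rewrite divr_gt0.
have [a [a1 ax]] := cluster_rep he hg.
have [N hN] := summable_tail a1 d4.
have eta0 l : 0 < d / 4 * 2^-1 ^+ l by rewrite mulr_gt0// exprn_gt0.
have [F [v [[v1 Fb] [Fv vS] Fc gn F0]]] := tower he N hg eta0.
have lg := cluster_linear hg; have g1 := cluster_le he hg.
exists (limit_coef g v); split.
- exact: (limit_coef_ball he d4 lg g1 v1 Fb vS gn).
- exact: (limit_space_contains he d4 lg g1 v1 Fb Fv vS Fc gn).
have low := limit_coef_norm_ge he d4 lg g1 v1 Fb vS gn.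
have gN : dual_norm g <= \sum_(0 <= i < N) `|a i| + d / 4.
  apply: (bounded_dual lg _ _).2; first by rewrite addr_ge0 ?sumr_ge0 ?ltW.
  move=> x; apply: (ler_cvgn (N := N) (cvg_norm (ax x))) => n Nn.
  apply: (@le_trans _ _ (\sum_(0 <= i < n) `|a i| * `|x|)).
    rewrite (le_trans (ler_norm_sum _ _ _))//; apply: ler_sum => i _.
    by rewrite normrM ler_wpM2l// basis_le.
  rewrite -mulr_suml ler_wpM2r// (@big_cat_nat _ _ +%R N)//= lerD2l.
  exact: hN.
(* The [v 0 j] are biorthogonal to [e 0, ..., e (N-1)], so [g (v 0 j) - a j] only involves
   coefficients of index at least [N]; for each such index the [|e i (v 0 j)|] sum to at most 1 over
   [j]. *)
have close : \sum_(0 <= j < N) `|a j - g (v 0%N j)| <= d / 4.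
  have cv : (fun n => \sum_(0 <= j < N)
      `|a j - series (fun i => a i * e i (v 0%N j) : R) n|) @ \oo -->
      \sum_(0 <= j < N) `|a j - g (v 0%N j)|.
    by apply: cvgn_sum => j; apply: cvg_norm; apply: cvgB; [exact: cvg_cst|exact: ax].
  apply: (ler_cvgn (N := N) cv) => n Nn; apply: le_trans (hN n Nn).
  apply: (@le_trans _ _ (\sum_(0 <= j < N) \sum_(N <= i < n) `|a i| * `|e i (v 0%N j)|)).
    rewrite [leLHS]big_nat [leRHS]big_nat; apply: ler_sum => j /andP[_ jN].
    rewrite /series/= (@big_cat_nat _ _ +%R N)//=.
    rewrite (bigD1_seq j) ?mem_index_iota ?iota_uniq//=.
    have ev i : (i < N)%N -> e i (v 0%N j) = (i == j)%:R.
      move=> iN; have := Fv 0%N i j; rewrite addn0 => /(_ iN jN) <-.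
      by rewrite F0// /signed_basis mul1r.
    rewrite ev// eqxx mulr1 big1_seq ?addr0; last first.
      move=> i /andP[ij]; rewrite mem_index_iota => /andP[_ iN].
      by rewrite ev// (negPf ij) mulr0.
    rewrite opprD addrA subrr add0r normrN (le_trans (ler_norm_sum _ _ _))//.
    by apply: ler_sum => i _; rewrite normrM.
  rewrite exchange_big/=; apply: ler_sum => i _; rewrite -mulr_sumr ler_piMr//.
  by have := v1 0%N i; rewrite addn0.
have : \sum_(0 <= i < N) `|a i| <= \sum_(0 <= j < N) (`|a j - g (v 0%N j)| + `|g (v 0%N j)|).
  by apply: ler_sum => j _; have := ler_distD (g (v 0%N j)) (a j) 0; rewrite !subr0.
rewrite big_split/=; move: low gN close => *; lra.
Qed.

End UpperBound.

(** * From a copy of W alpha to a weak* cluster point *)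

Section SpaceW.
Context {R : realType} (alpha : nat -> R^o).
Hypothesis alpha1 : forall n, \sum_(0 <= i < n) `|alpha i| <= 1.

Lemma coef_tail (d : R) : 0 < d ->
  exists M, forall N n, (M <= N)%N -> (N <= n)%N -> \sum_(N <= i < n) `|alpha i| <= d.
Proof.
move=> d0; have [M hM] := summable_tail alpha1 d0.
exists M => N n MN Nn; apply: le_trans (hM n (leq_trans MN Nn)).
by rewrite [leRHS](@big_cat_nat _ _ +%R N)//= lerDr sumr_ge0.
Qed.

(* The constant [c] on the tail is the only value compatible with the
   prescribed head, since [c] must equal [sum_(i < N) alpha i * u i + c * tau]
   where [tau] is the tail sum of [alpha]. *)
Lemma W_prescribe (u : nat -> R) (N : nat) (d : R) : d <= 2^-1 ->
  (forall n, (N <= n)%N -> \sum_(N <= i < n) `|alpha i| <= d) ->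
  exists c tau : R, [/\ `|tau| <= d, `|tau| <= 1 - \sum_(0 <= i < N) `|alpha i|,
    c = \sum_(0 <= i < N) alpha i * u i + c * tau,
    W alpha (fun k => if (k < N)%N then u k else c) &
    limn ((fun k => if (k < N)%N then u k else c) : nat -> R) = c].
Proof.
move=> d2 hd.
have ca : cvgn (series (alpha : nat -> R)).
  rewrite (_ : (alpha : nat -> R) = (fun i => alpha i * 1)); last first.
    by apply/funext => i; rewrite mulr1.
  by apply: (series_summable_cvg (D := 1) alpha1) => i; rewrite normr1.
pose tau : R := limn (series (alpha : nat -> R)) - \sum_(0 <= i < N) alpha i.
have ctau : (fun n => \sum_(N <= i < n) alpha i) @ \oo --> tau.
  have ct : (fun n => series (alpha : nat -> R) n - \sum_(0 <= i < N) alpha i) @ \oo --> tau.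
    by apply: cvgB => //; exact: cvg_cst.
  apply/cvgn_distP => eps /((cvgn_distP _ _).1 ct)[M hM].
  exists (maxn M N) => n Mn; have := hM n (leq_trans (leq_maxl _ _) Mn).
  rewrite /series/= (@big_cat_nat _ _ +%R N)//=; last exact: leq_trans (leq_maxr _ _) Mn.
  by rewrite [X in X - _]addrAC subrr add0r.
have taud : `|tau| <= d.
  apply: (ler_cvgn (N := N) (cvg_norm ctau)) => n Nn.
  by rewrite (le_trans (ler_norm_sum _ _ _))// hd.
have tau1 : `|tau| <= 1 - \sum_(0 <= i < N) `|alpha i|.
  apply: (ler_cvgn (N := N) (cvg_norm ctau)) => n Nn.
  rewrite (le_trans (ler_norm_sum _ _ _))// lerBrDl.
  by have := alpha1 n; rewrite (@big_cat_nat _ _ +%R N).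
have tau_lt : tau < 1 by have := ler_norm tau; move: d2 taud => *; lra.
pose c := (\sum_(0 <= i < N) alpha i * u i) / (1 - tau).
have cE : c = \sum_(0 <= i < N) alpha i * u i + c * tau.
  by rewrite /c; field; rewrite subr_eq0 eq_sym lt_eqF.
exists c, tau.
have cx : (fun k => if (k < N)%N then u k else c) @ \oo --> c.
  apply/cvgn_distP => eps eps0; exists N => k Nk.
  by rewrite ltnNge Nk/= subrr normr0 ltW.
have cs : series (fun k => alpha k * (if (k < N)%N then u k else c) : R) @ \oo --> c.
  have : (fun n => \sum_(0 <= i < N) alpha i * u i + c * \sum_(N <= i < n) alpha i) @ \oo --> c.
    by rewrite [X in _ --> X]cE; apply: cvgD; [exact: cvg_cst|exact: cvgMr].
  move=> ct; apply/cvgn_distP => eps /((cvgn_distP _ _).1 ct)[M hM].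
  exists (maxn M N) => n Mn; have := hM n (leq_trans (leq_maxl _ _) Mn).
  have Nn : (N <= n)%N := leq_trans (leq_maxr _ _) Mn.
  rewrite (_ : series _ n = \sum_(0 <= i < N) alpha i * u i + c * \sum_(N <= i < n) alpha i)//.
  rewrite /series/= (@big_cat_nat _ _ +%R N)//=; congr (_ + _).
    by apply: eq_big_nat => i /andP[_ iN]; rewrite iN.
  by rewrite mulr_sumr; apply: eq_big_nat => i /andP[Ni _]; rewrite ltnNge Ni mulrC.
have lx : limn (fun k => if (k < N)%N then u k else c) = c by exact: cvg_lim cx.
split=> //; split; first by apply/cvg_ex; exists c.
by rewrite lx (cvg_lim (@Rhausdorff R) cs).
Qed.

End SpaceW.

Section LowerBound.
Context {R : realType} {X : completeNormedModType R} (e : nat -> X -> R).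
Hypothesis he : ell1_basis e.
Variables (alpha : nat -> R^o) (Y : set X) (U : X -> nat -> R^o).
Hypothesis alpha1 : forall n, \sum_(0 <= i < n) `|alpha i| <= 1.
Hypothesis Ysub : is_subspace Y.
Hypothesis Ubij : set_bij Y (W alpha) U.
Hypothesis Ulin : forall (a : R) x y, Y x -> Y y -> U (a *: x + y) = a *: U x + U y.
Hypothesis Unorm : forall x, Y x -> sup_norm (U x) = `|x|.

Let UW y : Y y -> W alpha (U y). Proof. by case: Ubij => Uf _ _; exact: Uf. Qed.

Let Usurj x : W alpha x -> exists2 y, Y y & U y = x.
Proof. by case: Ubij => _ _ Us /Us[y]; exists y. Qed.

Let Ule y i : Y y -> `|U y i| <= `|y|.
Proof.
move=> Yy; rewrite -Unorm//; have [C hC] := W_bounded (UW Yy).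
exact: sup_norm_ub hC.
Qed.

Let Uge y C : Y y -> (forall i, `|U y i| <= C) -> `|y| <= C.
Proof. by move=> Yy hC; rewrite -Unorm//; exact: sup_norm_le. Qed.

Let Y0 : Y 0. Proof. by case: Ysub. Qed.

Let YD x y : Y x -> Y y -> Y (x + y).
Proof. by move=> Yx Yy; rewrite -[x]scale1r; exact: Ysub.2. Qed.

Let YZ a x : Y x -> Y (a *: x).
Proof. by move=> Yx; rewrite -[a *: x]addr0; exact: Ysub.2. Qed.

Let UD x y i : Y x -> Y y -> U (x + y) i = U x i + U y i.
Proof. by move=> Yx Yy; rewrite -{1}[x]scale1r Ulin// scale1r. Qed.

Let U0 i : U 0 i = 0.
Proof. by have := UD i Y0 Y0; rewrite addr0 => h; apply: (addrI (U 0 i)); rewrite -h addr0. Qed.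

Let UZ a x i : Y x -> U (a *: x) i = a * U x i.
Proof. by move=> Yx; rewrite -[a *: x]addr0 Ulin// [LHS](_ : _ = a * U x i + U 0 i)// U0 addr0. Qed.

Lemma peak_vector i : `|alpha i| <= 4^-1 -> exists2 y, Y y &
  U y i = 1 /\ forall j, j != i -> `|U y j| <= 2^-1.
Proof.
move=> ai; have h2 : 0 < 2^-1 :> R by rewrite invr_gt0.
have [M hM] := coef_tail alpha1 h2.
pose N := maxn M i.+1; have iN : (i < N)%N := leq_maxr _ _.
have [||c [tau [taud _ cE Wx _]]] := @W_prescribe _ alpha alpha1 (fun k => (k == i)%:R) N 2^-1.
- by [].
- by move=> n Nn; apply: hM => //; exact: leq_maxl.
have [y Yy yE] := Usurj Wx; exists y => //; rewrite yE iN eqxx; split=> // j ji.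
case: ifP => _; first by rewrite (negPf ji) normr0 ltW.
rewrite (bigD1_seq i) ?mem_index_iota ?iota_uniq//= eqxx mulr1 big1 ?addr0 in cE; last first.
  by move=> k /negPf ->; rewrite mulr0.
(* With [|tau| <= 1/2] this gives [|c| <= 2 * |alpha i|], whence the threshold 1/4. *)
have c1 : `|c| <= `|alpha i| + `|c| * `|tau| by rewrite -normrM {1}cE ler_normD.
have := ler_wpM2l (normr_ge0 c) taud; move: ai c1 => *; lra.
Qed.

(** Wherever a norm-one extension [f] of the coordinate attains its norm on the ball, so does the
    signed [e n] of any nonzero coefficient of [f]. This happens at [y0] and at its small
    perturbations in the kernel of the coordinate, so the signed [e n] vanishes on that kernel. *)
Lemma coord_is_signed_basis i : `|alpha i| <= 4^-1 ->
  exists n s, `|s| = 1 /\ forall y, Y y -> signed_basis e n s y = U y i.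
Proof.
move=> ai; have [y0 Yy0 [y0i y0j]] := peak_vector ai.
have y01 z : Y z -> U z i = 0 -> `|z| <= 2^-1 -> `|y0 + z| <= 1.
  move=> Yz zi z2; apply: Uge => [|j]; first exact: YD.
  rewrite UD//; have [->|ji] := eqVneq j i; first by rewrite y0i zi addr0 normr1.
  have := ler_normD (U y0 j) (U z j); have := y0j j ji; have := Ule j Yz.
  by move: z2 => *; lra.
(* The graph of a linear form is stable under negation, so its inequality constraints amount to
   equalities. *)
pose G : set (X * R) := [set k | exists2 y, Y y & k = (y, U y i)].
have [f [lf fn fG]] : exists f, [/\ linear_form f, forall x, f x <= `|x| &
    forall k, G k -> k.2 <= f k.1].
  apply: hahn_banach_cone.
  - by split=> [u v|a u a0]; [exact: ler_normD|rewrite normrZ gtr0_norm].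
  - split; first by exists 0; rewrite ?U0.
    + by move=> _ _ [x Yx ->] [y Yy ->]; exists (x + y); [exact: YD|rewrite /= UD].
    + by move=> a _ a0 [x Yx ->]; exists (a *: x); [exact: YZ|rewrite /= UZ].
  - by move=> _ [y Yy ->]/=; rewrite (le_trans (ler_norm _))// Ule.
have fU y : Y y -> f y = U y i.
  move=> Yy; have h1 := fG (y, U y i) (ex_intro2 _ _ y Yy erefl).
  have := fG (- y, U (- y) i); rewrite -scaleN1r UZ// mulN1r /= => /(_ _)/wrap[].
    by exists (-1 *: y); [exact: YZ|rewrite UZ// mulN1r].
  by rewrite scaleN1r linear_formN// lerN2 => h2; apply/eqP; rewrite eq_le h2.
have Bf : dual_ball f.
  apply: le_dual_ball => // x; rewrite ler_norml fn andbT lerNl -linear_formN//.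
  by rewrite (le_trans (fn _))// normrN.
have [a [a1 ax]] := dual_ball_rep he Bf.
have [n an0] : exists n, a n != 0.
  apply: contrapT => /forallNP a0; have := fU y0 Yy0; rewrite y0i => /eqP.
  have -> : f y0 = 0.
    apply: (cvg_unique (@Rhausdorff R) (ax y0)).
    rewrite [X in X @ _](_ : _ = cst 0); first exact: cvg_cst.
    apply/funext => N; rewrite /series/= big1// => k _.
    by have /negP := a0 k; rewrite negbK => /eqP ->; rewrite mul0r.
  by rewrite eq_sym oner_eq0.
pose s := Num.sg (a n).
have s1 : `|s| = 1 by rewrite normr_sg an0.
have alp : 0 < `|a n| by rewrite normr_gt0.
pose h := signed_basis e n s.
have lh : linear_form h := signed_basis_linear he n s.
(* The other terms of [f y = 1] contribute at most [1 - |a n|], so the [n]-th one reaches its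
   maximum [|a n|]. *)
have h1 y : f y = 1 -> `|y| <= 1 -> h y = 1.
  move=> fy y1; have := @rep_coef_dist _ _ _ he f a 1 n y a1 (ax y).
  rewrite fy {1}[a n]numEsg -/s => hd.
  have hle : h y <= 1 by rewrite (le_trans (ler_norm _))// (le_trans (signed_basis_le he _ _ s1)).
  have : 1 - `|a n| * h y <= 1 - `|a n|.
    rewrite /h /signed_basis mulrA [`|a n| * s]mulrC; apply: (le_trans (ler_norm _)).
    apply: (le_trans hd); rewrite ler_piMr// subr_ge0; exact: coef_le.
  rewrite lerD2l lerN2 ler_pMr// => hge.
  by apply/eqP; rewrite eq_le hle hge.
have fy0 : f y0 = 1 by rewrite fU.
have y0le : `|y0| <= 1 by rewrite -[y0]addr0 y01// ?U0// normr0.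
have h0 z : Y z -> U z i = 0 -> h z = 0.
  move=> Yz zi; pose t := (2 * (`|z| + 1))^-1.
  have z1 : 0 < `|z| + 1 by rewrite ltr_wpDl.
  have t0 : 0 < t by rewrite invr_gt0 mulr_gt0.
  have Ytz : Y (t *: z) by exact: YZ.
  have Utz : U (t *: z) i = 0 by rewrite UZ// zi mulr0.
  have tz2 : `|t *: z| <= 2^-1.
    rewrite normrZ gtr0_norm// /t mulrC ler_pdivrMr ?mulr_gt0// mulrA mulVf// mul1r.
    by rewrite lerDl.
  have := h1 (y0 + t *: z); rewrite fU; last exact: YD.
  rewrite UD// Utz addr0 y0i => /(_ erefl (y01 _ Ytz Utz tz2)).
  rewrite (linear_formD _ _ lh) (h1 y0)// (linear_formZ _ _ lh) => E.
  have /eqP : t * h z = 0 by lra.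
  by rewrite mulf_eq0 gt_eqF//= => /eqP.
exists n, s; split=> // y Yy.
have Yz : Y (y - U y i *: y0) by rewrite -scaleNr; apply: YD => //; exact: YZ.
have := h0 _ Yz; rewrite -scaleNr UD//; last exact: YZ.
rewrite UZ// y0i mulr1 subrr => /(_ erefl)/eqP.
by rewrite (linear_formD _ _ lh) (linear_formZ _ _ lh) (h1 y0)// mulr1 subr_eq0 => /eqP.
Qed.

(** Peak vectors separate the coordinates. Injectivity is what will make a limit of the [h i] a
    cluster point in the punctured sense. *)
Lemma coord_sequence : exists (i0 : nat) (h : nat -> X -> R^o),
  [/\ forall i, ext (@dual_ball R X) (h i), forall i y, Y y -> h i y = U y (i0 + i)%N &
    forall i j, h i = h j -> i = j].
Proof.
have h4 : 0 < 4^-1 :> R by rewrite invr_gt0.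
have [i0 hi0] := coef_tail alpha1 h4.
have small i : `|alpha (i0 + i)%N| <= 4^-1.
  have := hi0 (i0 + i)%N (i0 + i).+1 (leq_addr _ _) (leqnSn _).
  by rewrite big_nat1.
have /choice[h hh] i : exists h : X -> R^o, ext (@dual_ball R X) h /\
    forall y, Y y -> h y = U y (i0 + i)%N.
  have [n [s [s1 hU]]] := coord_is_signed_basis (small i).
  exists (signed_basis e n s); split=> //.
  by apply/(ext_dual_ballE he); exists n, s.
exists i0, h; split=> [i|i|i j hij]; [exact: (hh i).1|exact: (hh i).2|].
have [y Yy [yi yj]] := peak_vector (small i).
have : U y (i0 + j)%N = 1 by rewrite -(hh j).2// -hij (hh i).2.
have [//|ij Uj] := eqVneq i j.
have := yj (i0 + j)%N; rewrite eqn_add2l eq_sym => /(_ ij).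
by rewrite Uj normr1 => ?; exfalso; lra.
Qed.

Lemma cluster_on_copy : exists g : X -> R^o,
  weakstar_cluster (ext (@dual_ball R X)) g /\
  forall y, Y y -> g y = limn (U y : nat -> R).
Proof.
have [i0 [h [hext hU hinj]]] := coord_sequence.
have hB i : dual_ball (h i) by have [] := hext i.
(* Banach-Alaoglu through Tychonoff: [K] is a product of segments, and linearity of the limit is
   checked separately. *)
pose K := [set f : {ptws X -> R} | forall x, `[- `|x|, `|x|]%classic (f x)].
have cK : compact K.
  exact: (@tychonoff X (fun=> R) (fun x => `[- `|x|, `|x|]%classic)
    (fun x => @segment_compact R _ _)).
have hK : (h @ \oo) K.
  by exists 0%N => // i _ x /=; rewrite in_itv/= -ler_norml dual_ball_le.
have [g [gK gcl]] := cK _ (fmap_proper_filter h eventually_filter) hK.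
have near_g (B : set {ptws X -> R}) n : nbhs g B -> exists2 i, (n <= i)%N & B (h i).
  move=> nB; have tl : (h @ \oo) (h @` [set i | (n <= i)%N]).
    by exists n => // i /= ni; exists i.
  by have [_ [[i /= ni <-] Bi]] := gcl _ _ tl nB; exists i.
have near_ball (x : X) d n : 0 < d -> exists2 i, (n <= i)%N & `|h i x - g x| < d.
  by move=> d0; exact: near_g (ptws_nbhs_ball g x d0).
have g1 x : `|g x| <= `|x| by have := gK x; rewrite /= in_itv/= -ler_norml.
have lg : linear_form g.
  move=> a x y; apply/eqP; rewrite -subr_eq0 -normr_le0; apply/ler_addgt0Pr => d d0.
  have d1 : 0 < d / (2 + `|a|) by rewrite divr_gt0// ltr_wpDr.
  have [i _ [[/= b1 b2] b3]] := near_g _ 0%N (filterI (filterI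
    (ptws_nbhs_ball g (a *: x + y) d1) (ptws_nbhs_ball g x d1)) (ptws_nbhs_ball g y d1)).
  have lh : linear_form (h i) by case: (hB i) => dh _; exact: dual_linear_form.
  rewrite add0r.
  have -> : g (a *: x + y) - (a * g x + g y) = - (h i (a *: x + y) - g (a *: x + y)) +
      (a * (h i x - g x) + (h i y - g y)) by rewrite lh; ring.
  rewrite (le_trans (ler_normD _ _))// normrN.
  apply: (@le_trans _ _ (d / (2 + `|a|) + (`|a| * (d / (2 + `|a|)) + d / (2 + `|a|)))).
    rewrite lerD ?(ltW b1)// (le_trans (ler_normD _ _))// lerD ?(ltW b3)//.
    by rewrite normrM ler_wpM2l// ltW.
  rewrite le_eqVlt; apply/orP; left; apply/eqP; field.
  by rewrite gt_eqF// ltr_wpDr.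
exists g; split; first split.
- by apply: linear_form_dual => //; exists 1 => x; rewrite mul1r.
- move=> B nB; have [i _ Bi] := near_g B 0%N nB.
  (* If [h i] happens to be [g], any later term differs from it. *)
  have [hg|hg] := eqVneq (h i : {ptws X -> R}) g; last by exists (h i).
  have [j ij Bj] := near_g B i.+1 nB; exists (h j); split=> //.
  by apply/eqP => hjg; have := hinj j i; rewrite hjg hg => /(_ erefl) ji; rewrite ji ltnn in ij.
move=> y Yy; apply/eqP; rewrite -subr_eq0 -normr_le0; apply/ler_addgt0Pr => d d0.
have d2 : 0 < d / 2 by rewrite divr_gt0.
have [cU _] := UW Yy.
have [M hM] := (cvgn_distP _ _).1 cU _ d2.
have [i Mi hi] := near_ball y _ M d2.
have := hM (i0 + i)%N (leq_trans Mi (leq_addl _ _)); rewrite -(hU i y Yy).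
have := ler_distD (h i y) (g y) (limn (U y : nat -> R)).
by rewrite [`|g y - h i y|]distrC add0r; move: hi => *; lra.
Qed.

(** [g] is tested on the vector of [W alpha] carrying the signs of [alpha] on a long head; its limit
    [c] is nearly the norm of [alpha]. *)
Lemma copy_norm_le (g : X -> R^o) : dual g ->
  (forall y, Y y -> g y = limn (U y : nat -> R)) -> ell1_norm alpha <= dual_norm g.
Proof.
move=> dg gU; have [la _] := ell1_bounded alpha1.
apply/ler_addgt0Pr => d d0.
(* The bound [d / 2] controls [c * tau]; the bound 1/2 is what [W_prescribe] asks for. *)
pose d' := Num.min (d / 2) 2^-1.
have d'0 : 0 < d' by rewrite /d' lt_min divr_gt0// invr_gt0 ltr0n.
have [M1 hM1] := coef_tail alpha1 d'0.
have d2 : 0 < d / 2 by rewrite divr_gt0.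
have [M2 hM2] := (cvgn_distP _ _).1 la _ d2.
pose N := maxn M1 M2.
pose u k : R := (-1) ^+ (alpha k < 0)%R.
have [||c [tau [taud tau1 cE Wx lx]]] := @W_prescribe _ alpha alpha1 u N d'.
- by rewrite /d' ge_min lexx orbT.
- by move=> n Nn; apply: hM1 => //; exact: leq_maxl.
have d'd : d' <= d / 2 by rewrite /d' ge_min lexx.
have d'2 : d' <= 2^-1 by rewrite /d' ge_min lexx orbT.
have SE : \sum_(0 <= i < N) alpha i * u i = \sum_(0 <= i < N) `|alpha i|.
  by apply: eq_bigr => i _; rewrite /u mulrC normrEsign.
have S0 : 0 <= \sum_(0 <= i < N) `|alpha i| by rewrite sumr_ge0.
rewrite SE in cE; set S := \sum_(0 <= i < N) `|alpha i| in cE tau1 S0.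
have [t1 t2] : tau <= `|tau| /\ - `|tau| <= tau.
  by split; [exact: ler_norm|rewrite lerNl -normrN ler_norm].
have c0 : 0 <= c by move: cE taud d'2 => *; nra.
(* [S] is [c] times [1 - tau], and [tau1] gives [S <= 1 - tau]. *)
have c1 : c <= 1 by move: cE tau1 taud d'2 => *; nra.
have [y Yy yE] := Usurj Wx.
have y1 : `|y| <= 1.
  apply: Uge => // i; rewrite yE; case: ifP => _; first by rewrite /u normr_sign.
  by rewrite ger0_norm.
have := dual_norm_ub dg y1; rewrite gU// yE lx => /(le_trans (ler_norm _)) cg.
have := hM2 N (leq_maxr _ _); rewrite distrC => /(le_trans (ler_norm _)).
rewrite -[limn _]/(ell1_norm alpha) -[series _ N]/S => hS.
have : c * tau >= - (d / 2) by move: c0 c1 taud d'd => *; nra.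
by move: cE cg hS => *; lra.
Qed.

End LowerBound.

Theorem theorem6p2 (R : realType) (X : completeNormedModType R)
    (hX : ell1_predual X) :
  rstar X =
  ereal_sup [set (ell1_norm alpha)%:E | alpha in
    [set alpha : nat -> R^o | ell1_ball alpha /\
                              contains_isometric_copy X (W alpha) sup_norm]].
Proof.
have [e he] := ell1_predual_basis hX.
apply/eqP; rewrite eq_le; apply/andP; split.
  apply: ge_ereal_sup => _ [g hg <-]; apply/lee_addgt0Pr => d d0.
  have [alpha [alpha1 calpha le]] := cluster_approx he hg d0.
  apply: (@le_trans _ _ ((ell1_norm alpha)%:E + d%:E)%E); first by rewrite -EFinD lee_fin.
  by rewrite leeD2r//; apply: ereal_sup_ubound; exists alpha.
apply: ge_ereal_sup => _ [alpha [[la alpha1] [Y [Ysub _ [U [Ubij Ulin Unorm]]]]] <-].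
have al1 n : \sum_(0 <= i < n) `|alpha i| <= 1.
  exact: le_trans (ell1_partial_le n la) alpha1.
have [g [hg gU]] := cluster_on_copy he al1 Ysub Ubij Ulin Unorm.
apply: (@le_trans _ _ (dual_norm g)%:E); last by apply: ereal_sup_ubound; exists g.
by rewrite lee_fin; exact: (copy_norm_le al1 Ubij Unorm hg.1 gU).
Qed.
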